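(* Let $$\Omega_{\mathrm{KN}}=\Big\{(z,w)\in\mathbb{C}^2:\ \mathrm{Re}\,w+|zw|^2+|z|^8+\tfrac{15}{7}|z|^2\,\mathrm{Re}\,z^6<0\Big\}.$$ Then for every boundary point $p\in\partial\Omega_{\mathrm{KN}}$ there is a peak function at $p$ for $\mathcal{O}(\Omega_{\mathrm{KN}})$.
   Context: $\mathcal{O}(\Omega)$ is the set of holomorphic functions $\Omega\to\mathbb{C}$ on an open set $\Omega$, and $B^n(p,r)=\{z\in\mathbb{C}^n:\|z-p\|<r\}$ with $\|\cdot\|$ the Euclidean norm. For an open set $\Omega\subset\mathbb{C}^n$ and $p\in\partial\Omega$, a peak function at $p$ for $\mathcal{O}(\Omega)$ is an $f\in\mathcal{O}(\Omega)$ such that (i) $\lim_{\Omega\ni z\to p}f(z)=1$, and (ii) for every $r>0$ there exists $s>0$ with $|f(z)|<1-s$ for every $z\in\Omega\setminus B^n(p,r)$. *)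

(* Defs.v *)
From Stdlib Require Import Reals.
From Coquelicot Require Import Coquelicot.
Open Scope R_scope.

(* The norm Coquelicot puts on a product is sqrt (|.|^2 + |.|^2), and the norm of
   C_NormedModule is Cmod; hence [norm] on C2 is the Euclidean norm. *)
Definition C2 : NormedModule C_AbsRing :=
  prod_NormedModule C_AbsRing C_NormedModule C_NormedModule.

Definition closure {T : UniformSpace} (A : T -> Prop) (p : T) : Prop :=
  forall P : T -> Prop, locally p P -> exists q, P q /\ A q.

(* [locally p A] says that p is an interior point of A. *)
Definition boundary {T : UniformSpace} (A : T -> Prop) (p : T) : Prop :=
  closure A p /\ ~ locally p A.

Definition norm_ball {U : NormedModule C_AbsRing} (p : U) (r : R) (z : U) : Prop :=
  norm (minus z p) < r.

(* The scalars are C_AbsRing, so the differential is C-linear.  Functions are total;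
   for open Omega the values outside Omega are irrelevant. *)
Definition holomorphic {U : NormedModule C_AbsRing}
    (Omega : U -> Prop) (f : U -> C) : Prop :=
  forall z : U, Omega z ->
    ex_filterdiff (K := C_AbsRing) (U := U) (V := C_NormedModule) f (locally z).

Definition peak_function {U : NormedModule C_AbsRing}
    (Omega : U -> Prop) (p : U) (f : U -> C) : Prop :=
  holomorphic Omega f /\
  filterlim f (within Omega (locally p)) (locally (T := C_UniformSpace) (RtoC 1)) /\
  (forall r : R, 0 < r ->
     exists s : R, 0 < s /\
       forall z : U, Omega z -> ~ norm_ball p r z -> Cmod (f z) < 1 - s).

Definition Omega_KN (x : C2) : Prop :=
  let z : C := fst x in
  let w : C := snd x in
  Re w + Cmod (z * w)%C ^ 2 + Cmod z ^ 8 + 15 / 7 * Cmod z ^ 2 * Re (z ^ 6)%C < 0.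

(* Main.v *)
(* Put P(z) = |z|^8 + 15/7 |z|^2 Re z^6, so the domain is Re w + |zw|^2 + P(z) < 0.
   For any y, |zw|^2 = Re(2 conj(y) zw) - |y|^2 + |zw - y|^2; absorbing the holomorphic
   part into w, it suffices to treat boundary points of the homogeneous domain
   D = {Re w + P(z) < 0} at which zw = y.

   On D the quartic T^4 + 2 z^6 T + w has exactly one root T(z,w) in the convex region
   V = {|Im T| < Re T / 2, Re(2 T^3 + z^6) > 0}: its derivative has positive real part
   on V, which gives uniqueness and continuity, and on the boundary of V the quartic itself
   has negative real part, which gives existence.  So T is holomorphic, Re T > 0, and
   T = 0 only at the origin: 1 / (1 + T) is a peak function at the points with z = 0.

   At a point with z = z0 <> 0 let k = T(z0, w0), with Im w0 chosen so that
   Re(w + c z^8) <= 0 holds on D near the ray through (z0, w0), where c z0^8 = - w0.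
   There G = T - k (z/z0)^2 vanishes, and on D it avoids (-oo, 0], so that G^(1/4) is
   holomorphic with dominant positive real part.  It vanishes on the rays through
   (+-z0, w0), and adding (z/z0 - 1)^2 / (1 + T/k) singles out the point: on D the real
   part of the latter is bounded below by a multiple of - |G|^(1/4). *)
Require Import Defs.
From Stdlib Require Import Reals Lra Psatz ClassicalEpsilon.
From Coquelicot Require Import Coquelicot.
Open Scope R_scope.

(** * Polynomial inequalities *)

(** This is the Kohn-Nirenberg domain: a holomorphic function defined near the origin and vanishing
    there also has zeros inside the domain, so no support function is holomorphic across the origin
    and a branched one is needed. The quartic comes from homogeneity: with weights 1, 2, 8 for z, T,
    w, the variable T stands in for |z|^2 and T^4 + 2 z^6 T imitates P. The coefficient 2, a little
    below 15/7, and the slope 1/2 of the cone leave |z|^8 / 100 to spare on the boundary of V. The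
    slope also forces any two values of T to make an angle of cosine at least 3/5, above the
    threshold 14/25 of the sector where P is compared with its osculating form. The surplus |zw -
    y|^2 cannot simply be dropped: the change of w is not injective where 1 + 2 conj(y) z = 0, and
    there only the surplus bounds the distance in w. *)

Lemma prod_pow_nonneg (p q r s : R) (i j k l : nat) :
  0 <= p -> 0 <= q -> 0 <= r -> 0 <= s -> 0 <= p ^ i * q ^ j * (r ^ k * s ^ l).
Proof.
  intros hp hq hr hs.
  repeat apply Rmult_le_pos; apply pow_le; assumption.
Qed.

(* The boundary curve [Re (2 T ^ 3 + u) = 0] for [Re T = 1], [Im T ^ 2 = Y], [t = |z|^2], after
   bounding the cross term by [2 |Im T Im u| <= 3 t^2 Y + (Im u)^2 / (3 t^2)]. *)
Lemma curve_poly (t Y : R) : 0 <= t -> 0 <= Y <= 1 / 4 ->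
  0 <= 197 / 300 * t ^ 6 - 30 / 7 * t ^ 3 * (1 - 3 * Y)
       + t ^ 2 * (3 - 6 * Y - Y ^ 2) + 4 / 3 * (1 - 3 * Y) ^ 2 - 3 * t ^ 4 * Y.
Proof.
  intros ht [hY0 hY1].
  assert (piece : forall p q, 0 <= p -> 0 <= q -> forall i j k l,
            0 <= p ^ i * q ^ j * (Y ^ k * (1 / 4 - Y) ^ l))
    by (intros; apply prod_pow_nonneg; lra).
  (* Bernstein certificates: on the two bounded pieces the polynomial is a nonnegative combination
     of the listed products; on the unbounded piece powers of [t - 17 / 10] take their place. *)
  destruct (Rle_dec t (23 / 20)); [|destruct (Rle_dec t (17 / 10))].
  - assert (H := piece t (23 / 20 - t) ltac:(lra) ltac:(lra)).
    generalize (H 0 6 0 2)%nat (H 0 6 1 1)%nat (H 0 6 2 0)%nat (H 1 5 0 2)%nat (H 1 5 1 1)%nat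
     (H 1 5 2 0)%nat (H 2 4 0 2)%nat (H 2 4 1 1)%nat (H 2 4 2 0)%nat (H 3 3 0 2)%nat (H 3 3 1 1)%nat
     (H 3 3 2 0)%nat (H 4 2 0 2)%nat (H 4 2 1 1)%nat (H 4 2 2 0)%nat (H 5 1 0 2)%nat (H 5 1 1 1)%nat
     (H 5 1 2 0)%nat (H 6 0 0 2)%nat (H 6 0 1 1)%nat (H 6 0 2 0)%nat.
    clear - ht; intros; lra.
  - assert (H := piece (t - 23 / 20) (17 / 10 - t) ltac:(lra) ltac:(lra)).
    generalize (H 0 6 0 2)%nat (H 0 6 1 1)%nat (H 0 6 2 0)%nat (H 1 5 0 2)%nat (H 1 5 1 1)%nat
     (H 1 5 2 0)%nat (H 2 4 0 2)%nat (H 2 4 1 1)%nat (H 2 4 2 0)%nat (H 3 3 0 2)%nat (H 3 3 1 1)%nat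
     (H 3 3 2 0)%nat (H 4 2 0 2)%nat (H 4 2 1 1)%nat (H 4 2 2 0)%nat (H 5 1 0 2)%nat (H 5 1 1 1)%nat
     (H 5 1 2 0)%nat (H 6 0 0 2)%nat (H 6 0 1 1)%nat (H 6 0 2 0)%nat.
    clear - ht; intros; lra.
  - assert (H := piece (t - 17 / 10) 1 ltac:(lra) ltac:(lra)).
    generalize (H 0 0 0 2)%nat (H 0 0 1 1)%nat (H 0 0 2 0)%nat (H 1 0 0 2)%nat (H 1 0 1 1)%nat
     (H 1 0 2 0)%nat (H 2 0 0 2)%nat (H 2 0 1 1)%nat (H 2 0 2 0)%nat (H 3 0 0 2)%nat (H 3 0 1 1)%nat
     (H 3 0 2 0)%nat (H 4 0 0 2)%nat (H 4 0 1 1)%nat (H 4 0 2 0)%nat (H 5 0 0 2)%nat (H 5 0 1 1)%nat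
     (H 5 0 2 0)%nat (H 6 0 0 2)%nat (H 6 0 1 1)%nat (H 6 0 2 0)%nat.
    clear - ht; intros; lra.
Qed.

Lemma boundary_curve (t y a b : R) :
  0 <= t -> a ^ 2 + b ^ 2 = t ^ 6 -> 2 * y <= 1 -> -1 <= 2 * y ->
  2 * (1 - 3 * y ^ 2) + a = 0 ->
  1 - 6 * y ^ 2 + y ^ 4 + 2 * (a - b * y) <= 99 / 100 * t ^ 4 + 15 / 7 * t * a.
Proof.
  intros ht hab hy1 hy2 ha.
  assert (hY : 0 <= y ^ 2 <= 1 / 4) by nra.
  assert (hP := curve_poly t (y ^ 2) ht hY).
  assert (ht0 : 0 < t).
  { destruct ht as [|<-]; [assumption|]. exfalso. nra. }
  (* The AM-GM square; with [b ^ 2 = t ^ 6 - a ^ 2] it costs [t ^ 4 / 3], which turns [99 / 100]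
     into [197 / 300]. *)
  assert (hamgm := pow2_ge_0 (3 * t ^ 2 * y + b)).
  apply Rmult_le_reg_l with (t ^ 2); [nra|].
  assert (ha' : a = - 2 * (1 - 3 * y ^ 2)) by lra.
  clear - hP hab hamgm ha'; subst a.
  lra.
Qed.

Lemma boundary_ray (t y a b : R) :
  0 <= t -> a ^ 2 + b ^ 2 = t ^ 6 -> y ^ 2 = 1 / 4 -> 0 <= 2 * (1 - 3 * y ^ 2) + a ->
  1 - 6 * y ^ 2 + y ^ 4 + 2 * (a - b * y) <= 99 / 100 * t ^ 4 + 15 / 7 * t * a.
Proof.
  intros ht hab hy ha.
  assert (hy4 : y ^ 4 = 1 / 16) by (replace (y ^ 4) with ((y ^ 2) ^ 2) by ring; rewrite hy; field).
  rewrite hy4, hy. rewrite hy in ha.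
  assert (ht3 : 0 <= t ^ 3) by (apply pow_le; assumption).
  assert (hb : - (2 * b * y) <= t ^ 3) by nra.
  assert (ha' : a <= t ^ 3) by nra.
  (* Once [b] is estimated, the inequality is affine in [a] and its slope changes sign at
     [t = 14 / 15]: the worst case is [a = t ^ 3] before and [a = - 1 / 2] after. *)
  destruct (Rle_dec t (14 / 15)).
  - assert (0 <= (2 - 15 / 7 * t) * (t ^ 3 - a)) by nra.
    assert (0 <= 99 / 100 * t ^ 4 + 7 / 16 - 3 * t ^ 3 + 15 / 7 * t ^ 4).
    { assert (h1 := pow2_ge_0 (t ^ 2 - 3/7 * t - 1/5)). nra. }
    nra.
  - assert (0 <= (15 / 7 * t - 2) * (a + 1/2)) by nra.
    assert (0 <= 99 / 100 * t ^ 4 - t ^ 3 - 15 / 14 * t + 23 / 16).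
    { assert (h1 := pow2_ge_0 (t ^ 2 - 1/2 * t - 3/4)). nra. }
    nra.
Qed.

(** Here [x + i y] is [T], [a + i b] is [z ^ 6] and [t] is [|z| ^ 2]. Everything is homogeneous for
    the weights 1, 3, 1 of these, which reduces to [x = 1]; at the apex [x = 0] the hypotheses leave
    [a >= 0]. *)
Lemma boundary_ineq (x y t a b : R) :
  0 <= t -> a ^ 2 + b ^ 2 = t ^ 6 -> 2 * y <= x -> - x <= 2 * y ->
  0 <= 2 * (x ^ 3 - 3 * x * y ^ 2) + a ->
  2 * y = x \/ 2 * y = - x \/ 2 * (x ^ 3 - 3 * x * y ^ 2) + a = 0 ->
  x ^ 4 - 6 * x ^ 2 * y ^ 2 + y ^ 4 + 2 * (a * x - b * y)
    <= 99 / 100 * t ^ 4 + 15 / 7 * t * a.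
Proof.
  intros ht hab hy1 hy2 ha hb.
  destruct (Rle_lt_or_eq_dec 0 x ltac:(lra)) as [hx|<-].
  - set (y' := y / x). set (t' := t / x). set (a' := a / x ^ 3). set (b' := b / x ^ 3).
    assert (hx3 : 0 < x ^ 3) by (apply pow_lt; lra).
    assert (ey : y = x * y') by (unfold y'; field; lra).
    assert (et : t = x * t') by (unfold t'; field; lra).
    assert (ea : a = x ^ 3 * a') by (unfold a'; field; lra).
    assert (eb : b = x ^ 3 * b') by (unfold b'; field; lra).
    clearbody y' t' a' b'. subst y t a b.
    assert (ht' : 0 <= t') by nra.
    assert (hab' : a' ^ 2 + b' ^ 2 = t' ^ 6).
    { apply Rmult_eq_reg_l with (x ^ 6); [|apply pow_nonzero; lra]. lra. }
    assert (hy1' : 2 * y' <= 1) by (apply Rmult_le_reg_l with x; lra).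
    assert (hy2' : -1 <= 2 * y') by (apply Rmult_le_reg_l with x; lra).
    assert (ha' : 0 <= 2 * (1 - 3 * y' ^ 2) + a')
      by (apply Rmult_le_reg_l with (x ^ 3); lra).
    enough (1 - 6 * y' ^ 2 + y' ^ 4 + 2 * (a' - b' * y')
      <= 99 / 100 * t' ^ 4 + 15 / 7 * t' * a').
    { apply (Rmult_le_compat_l (x ^ 4)) in H; [lra|apply pow_le; lra]. }
    destruct hb as [hb|[hb|hb]].
    + apply boundary_ray; try assumption.
      replace y' with (1 / 2) by (apply Rmult_eq_reg_l with x; lra). field.
    + apply boundary_ray; try assumption.
      replace y' with (- (1 / 2)) by (apply Rmult_eq_reg_l with x; lra). field.
    + apply boundary_curve; try assumption.
      apply Rmult_eq_reg_l with (x ^ 3); lra.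
  - replace y with 0 in * by lra.
    assert (0 <= t * a) by (apply Rmult_le_pos; lra).
    assert (0 <= t ^ 4) by (apply pow_le; assumption). lra.
Qed.

(** The Cauchy-Schwarz bound used next, after [q ^ 2 = 1 - p ^ 2]; the certificate is an expansion
    in the Bernstein basis of [[14 / 25, 1]]. *)
Lemma sector_gap_poly (p : R) : 14 / 25 <= p <= 1 ->
  (15 / 7) ^ 2 * ((8 * p ^ 3 + 4 * p ^ 2 - 4 * p - 1) ^ 2
                   + (1 - p ^ 2) * (6 * p ^ 2 + 2 * p - 1) ^ 2)
    <= (39 / 5 * p ^ 2 * (1 + p)) ^ 2.
Proof.
  intros [h1 h2].
  assert (piece : forall i j, 0 <= (p - 14 / 25) ^ i * (1 - p) ^ j)
    by (intros; apply Rmult_le_pos; apply pow_le; lra).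
  generalize (piece 0 6)%nat (piece 1 5)%nat (piece 2 4)%nat (piece 3 3)%nat
    (piece 4 2)%nat (piece 5 1)%nat (piece 6 0)%nat.
  clear. intros. lra.
Qed.

(** The factor [3 / 4 = 6 / 8] matches the angular derivatives of terms of frequency 6 and 8 in [s],
    so the right side vanishes to second order at [p = 1]. It equals [8 p ^ 2 q ^ 2] plus [1 - p]
    times a linear form in [(e, f)]; Cauchy-Schwarz on the latter costs [39 / 5] and leaves
    [1 / 5]. *)
Lemma sector_gap_unit (e f p q : R) :
  e ^ 2 + f ^ 2 = 1 -> p ^ 2 + q ^ 2 = 1 -> 14 / 25 <= p ->
  p ^ 2 * q ^ 2 / 5 <=
    1 + 15 / 7 * (e * (p ^ 3 - 3 * p * q ^ 2) - f * (3 * p ^ 2 * q - q ^ 3))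
    - (p ^ 4 - 6 * p ^ 2 * q ^ 2 + q ^ 4)
    - 15 / 7 * (e * (p ^ 4 - 6 * p ^ 2 * q ^ 2 + q ^ 4)
                - 3 / 4 * f * (4 * p ^ 3 * q - 4 * p * q ^ 3)).
Proof.
  intros hef hpq hp.
  assert (hp1 : p <= 1) by nra.
  assert (hW := sector_gap_poly p (conj hp hp1)).
  set (A1 := 8 * p ^ 3 + 4 * p ^ 2 - 4 * p - 1) in hW.
  set (B1 := 6 * p ^ 2 + 2 * p - 1) in hW.
  replace (1 - p ^ 2) with (q ^ 2) in hW by lra.
  assert (hZ : 0 <= 39 / 5 * p ^ 2 * (1 + p)) by (assert (0 <= p ^ 2) by nra; nra).
  assert (hcs : (15 / 7 * (e * A1 - f * (q * B1))) ^ 2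
                <= (39 / 5 * p ^ 2 * (1 + p)) ^ 2).
  { assert (h := pow2_ge_0 (f * A1 + e * (q * B1))).
    assert ((e * A1 - f * (q * B1)) ^ 2 + (f * A1 + e * (q * B1)) ^ 2
            = (e ^ 2 + f ^ 2) * (A1 ^ 2 + q ^ 2 * B1 ^ 2)) by ring.
    rewrite hef in H. nra. }
  assert (hlow : - (39 / 5 * p ^ 2 * (1 + p)) <= 15 / 7 * (e * A1 - f * (q * B1))).
  { apply Rsqr_neg_pos_le_0; [unfold Rsqr; lra | assumption]. }
  apply (Rmult_le_compat_l (1 - p)) in hlow; [|lra].
  assert (hq : q ^ 2 = 1 - p ^ 2) by lra.
  assert (E : 1 + 15 / 7 * (e * (p ^ 3 - 3 * p * q ^ 2) - f * (3 * p ^ 2 * q - q ^ 3))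
    - (p ^ 4 - 6 * p ^ 2 * q ^ 2 + q ^ 4)
    - 15 / 7 * (e * (p ^ 4 - 6 * p ^ 2 * q ^ 2 + q ^ 4)
                - 3 / 4 * f * (4 * p ^ 3 * q - 4 * p * q ^ 3))
    = 8 * p ^ 2 * q ^ 2 + (1 - p) * (15 / 7 * (e * A1 - f * (q * B1)))).
  { unfold A1, B1.
    replace (q ^ 3) with (q ^ 2 * q) by ring. replace (q ^ 4) with (q ^ 2 * q ^ 2) by ring.
    rewrite hq. field. }
  rewrite E.
  replace ((1 - p) * - (39 / 5 * p ^ 2 * (1 + p))) with (- (39 / 5 * (p ^ 2 * q ^ 2))) in hlow
    by (rewrite hq; field).
  lra.
Qed.

(* [p + i q] is the square of [s = z / z0], [r = |s|^2], and [e + i f] is [z0 ^ 6 / |z0| ^ 6]. *)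
Lemma sector_gap (e f p q r : R) :
  e ^ 2 + f ^ 2 = 1 -> 0 <= r -> p ^ 2 + q ^ 2 = r ^ 2 -> 14 / 25 * r <= p ->
  p ^ 2 * q ^ 2 / 5 <=
    r ^ 4 + 15 / 7 * r * (e * (p ^ 3 - 3 * p * q ^ 2) - f * (3 * p ^ 2 * q - q ^ 3))
    - (p ^ 4 - 6 * p ^ 2 * q ^ 2 + q ^ 4)
    - 15 / 7 * (e * (p ^ 4 - 6 * p ^ 2 * q ^ 2 + q ^ 4)
                - 3 / 4 * f * (4 * p ^ 3 * q - 4 * p * q ^ 3)).
Proof.
  intros hef hr hpq hp.
  destruct hr as [hr|<-].
  - set (p' := p / r). set (q' := q / r).
    assert (ep : p = r * p') by (unfold p'; field; lra).
    assert (eq : q = r * q') by (unfold q'; field; lra).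
    clearbody p' q'. subst p q.
    assert (hpq' : p' ^ 2 + q' ^ 2 = 1)
      by (apply Rmult_eq_reg_l with (r ^ 2); [lra|apply pow_nonzero; lra]).
    assert (h := sector_gap_unit e f p' q' hef hpq'
                   ltac:(apply Rmult_le_reg_l with r; lra)).
    apply (Rmult_le_compat_l (r ^ 4)) in h; [lra|apply pow_le; lra].
  - assert (p = 0) by nra. assert (q = 0) by nra. subst. lra.
Qed.

(** * Continuity and minima in the complex plane *)

(* Not Coquelicot's [continuous]: its lemmas for [C_AbsRing] and for [C_NormedModule] refer to
   uniform structures on [C] that are not convertible. *)
Definition ccont {U : UniformSpace} (f : U -> C) (x : U) : Prop :=
  forall eps : R, 0 < eps -> locally x (fun y => Cmod (f y - f x) < eps).

Lemma ccont_const {U : UniformSpace} (c : C) (x : U) : ccont (fun _ => c) x.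
Proof.
  intros eps heps. apply filter_forall. intros y.
  replace (c - c)%C with (RtoC 0) by ring. now rewrite Cmod_0.
Qed.

Lemma ccont_plus {U : UniformSpace} (f g : U -> C) (x : U) :
  ccont f x -> ccont g x -> ccont (fun y => f y + g y)%C x.
Proof.
  intros hf hg eps heps.
  assert (he : 0 < eps / 2) by lra.
  generalize (filter_and _ _ (hf _ he) (hg _ he)).
  apply filter_imp. intros y [h1 h2].
  replace (f y + g y - (f x + g x))%C with ((f y - f x) + (g y - g x))%C by ring.
  eapply Rle_lt_trans; [apply Cmod_triangle|lra].
Qed.

Lemma ccont_mult {U : UniformSpace} (f g : U -> C) (x : U) :
  ccont f x -> ccont g x -> ccont (fun y => f y * g y)%C x.
Proof.
  intros hf hg eps heps.
  set (M := Cmod (f x) + Cmod (g x) + 1).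
  assert (hfx := Cmod_ge_0 (f x)). assert (hgx := Cmod_ge_0 (g x)).
  set (e := Rmin 1 (eps / (2 * M))).
  assert (he : 0 < e) by (apply Rmin_case; [lra|apply Rdiv_lt_0_compat; unfold M; lra]).
  assert (he1 : e <= 1) by apply Rmin_l.
  assert (heM : e * M <= eps / 2).
  { apply Rle_trans with (eps / (2 * M) * M).
    - apply Rmult_le_compat_r; [unfold M; lra|apply Rmin_r].
    - right. field. unfold M; lra. }
  generalize (filter_and _ _ (hf e he) (hg e he)).
  apply filter_imp. intros y [h1 h2].
  replace (f y * g y - f x * g x)%C
    with ((f y - f x) * (g y - g x) + (f y - f x) * g x + f x * (g y - g x))%C by ring.
  eapply Rle_lt_trans; [apply Cmod_triangle|].
  eapply Rle_lt_trans; [apply Rplus_le_compat_r, Cmod_triangle|].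
  rewrite !Cmod_mult.
  assert (h3 := Cmod_ge_0 (f y - f x)). assert (h4 := Cmod_ge_0 (g y - g x)).
  assert (Cmod (f y - f x) * Cmod (g y - g x) <= e * 1) by (apply Rmult_le_compat; lra).
  assert (Cmod (f y - f x) * Cmod (g x) <= e * Cmod (g x))
    by (apply Rmult_le_compat_r; lra).
  assert (Cmod (f x) * Cmod (g y - g x) <= Cmod (f x) * e)
    by (apply Rmult_le_compat_l; lra).
  unfold M in heM. nra.
Qed.

Lemma ccont_opp {U : UniformSpace} (f : U -> C) (x : U) :
  ccont f x -> ccont (fun y => - f y)%C x.
Proof.
  intros hf eps heps. generalize (hf eps heps). apply filter_imp. intros y hy.
  replace (- f y - - f x)%C with (- (f y - f x))%C by ring. now rewrite Cmod_opp.
Qed.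

Lemma ccont_minus {U : UniformSpace} (f g : U -> C) (x : U) :
  ccont f x -> ccont g x -> ccont (fun y => f y - g y)%C x.
Proof. intros hf hg. apply ccont_plus; [assumption|now apply ccont_opp]. Qed.

Lemma ccont_pow {U : UniformSpace} (f : U -> C) (n : nat) (x : U) :
  ccont f x -> ccont (fun y => f y ^ n)%C x.
Proof.
  intros hf. induction n as [|n IH]; simpl; [apply ccont_const|now apply ccont_mult].
Qed.

Lemma Cmod_le_abs (z : C) : Cmod z <= Rabs (Re z) + Rabs (Im z).
Proof.
  assert (h1 := Rabs_pos (Re z)). assert (h2 := Rabs_pos (Im z)).
  apply Rsqr_incr_0_var; [|lra]. unfold Rsqr.
  replace (Cmod z * Cmod z) with (Cmod z ^ 2) by ring. rewrite Cmod2_alt.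
  rewrite <- (pow2_abs (Re z)), <- (pow2_abs (Im z)). nra.
Qed.

Lemma im_le_Cmod (z : C) : Rabs (Im z) <= Cmod z.
Proof. eapply Rle_trans; [apply Rmax_r|apply Rmax_Cmod]. Qed.

Lemma ccont_id (x : C) : ccont (U := C_UniformSpace) (fun y => y) x.
Proof.
  intros eps heps. exists (mkposreal (eps / 2) ltac:(lra)).
  intros y [h1 h2].
  eapply Rle_lt_trans; [apply Cmod_le_abs|].
  change (Rabs (fst y - fst x) < eps / 2) in h1.
  change (Rabs (snd y - snd x) < eps / 2) in h2.
  unfold Re, Im; simpl. unfold Rminus in *. lra.
Qed.

Lemma ccont_Re_gt {U : UniformSpace} (f : U -> C) (x : U) (c : R) :
  ccont f x -> c < Re (f x) -> locally x (fun y => c < Re (f y)).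
Proof.
  intros hf hc. generalize (hf (Re (f x) - c) ltac:(lra)). apply filter_imp. intros y hy.
  assert (h := Rle_lt_trans _ _ _ (re_le_Cmod _) hy).
  apply Rabs_def2 in h. unfold Re in *; simpl in h. lra.
Qed.

Lemma ccont_Cmod_gt {U : UniformSpace} (f : U -> C) (x : U) (c : R) :
  ccont f x -> c < Cmod (f x) -> locally x (fun y => c < Cmod (f y)).
Proof.
  intros hf hc. generalize (hf (Cmod (f x) - c) ltac:(lra)). apply filter_imp. intros y hy.
  assert (h := Cmod_triangle (f y) (- (f y - f x))). rewrite Cmod_opp in h.
  replace (f y + - (f y - f x))%C with (f x) in h by ring. lra.
Qed.

(** If the infimum [- s] is not attained, each point of the square has a radius within which [|f|]
    exceeds the infimum on [K] by that same radius, vacuously off [K]. Compactness makes the margin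
    uniform, contradicting the infimum. *)
Lemma closed_bounded_min (K : C -> Prop) (f : C -> C) (L : R) :
  (forall z, K z -> Cmod z <= L) ->
  (forall z, ~ K z -> locally (T := C_UniformSpace) z (fun z' => ~ K z')) ->
  (forall z, ccont (U := C_UniformSpace) f z) ->
  (exists z, K z) ->
  exists z, K z /\ forall z', K z' -> Cmod (f z) <= Cmod (f z').
Proof.
  intros hL hK hf [z0 hz0].
  destruct (completeness (fun r => exists z, K z /\ r = - Cmod (f z))) as [s [hs1 hs2]].
  - exists 0. intros r [z [_ ->]]. generalize (Cmod_ge_0 (f z)); lra.
  - now exists (- Cmod (f z0)), z0.
  - destruct (classic (exists z, K z /\ Cmod (f z) = - s)) as [[z [h1 h2]]|hno].
    + exists z. split; [assumption|]. intros z' hz'.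
      assert (- Cmod (f z') <= s) by (apply hs1; now exists z'). lra.
    + exfalso.
      assert (hd : forall u v : R, exists d : posreal, forall x y,
        Rabs (x - u) < d -> Rabs (y - v) < d -> K (x, y) -> - s + d <= Cmod (f (x, y))).
      { intros u v. destruct (classic (K (u, v))) as [huv|huv].
        - assert (hgt : - s < Cmod (f (u, v))).
          { assert (h : - Cmod (f (u, v)) <= s) by (apply hs1; now exists (u, v)).
            destruct (Req_dec (Cmod (f (u, v))) (- s)); [|lra].
            exfalso; apply hno; now exists (u, v). }
          destruct (ccont_Cmod_gt f (u, v) ((Cmod (f (u, v)) - s) / 2) (hf _) ltac:(lra))
            as [d hdd].
          exists (mkposreal (Rmin d ((Cmod (f (u, v)) + s) / 2))
                    ltac:(apply Rmin_case; [apply cond_pos|lra])).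
          simpl. intros x y hx hy _.
          assert (h1 := Rmin_l d ((Cmod (f (u, v)) + s) / 2)).
          assert (h2 := Rmin_r d ((Cmod (f (u, v)) + s) / 2)).
          assert (h : (Cmod (f (u, v)) - s) / 2 < Cmod (f (x, y))).
          { apply hdd. split; simpl; [apply (Rlt_le_trans _ _ _ hx h1)
                                    | apply (Rlt_le_trans _ _ _ hy h1)]. }
          lra.
        - destruct (hK _ huv) as [d hdd]. exists d. intros x y hx hy hxy.
          exfalso. apply (hdd (x, y)); [now split|assumption]. }
      pose (delta := fun u v => proj1_sig (constructive_indefinite_description _ (hd u v))).
      assert (hdelta : forall u v x y, Rabs (x - u) < delta u v -> Rabs (y - v) < delta u v ->
        K (x, y) -> - s + delta u v <= Cmod (f (x, y)))
        by (intros u v; exact (proj2_sig (constructive_indefinite_description _ (hd u v)))).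
      destruct (compactness_value_2d (- L) L (- L) L delta) as [d hdd].
      assert (hs : exists z, K z /\ Cmod (f z) < - s + d).
      { apply NNPP. intros hn.
        assert (s <= s - d).
        { apply hs2. intros r [z [hz ->]]. apply Rnot_lt_le. intros hlt.
          apply hn. exists z. split; [assumption|lra]. }
        generalize (cond_pos d); lra. }
      destruct hs as [[x y] [hxy hlt]].
      assert (hb := hL _ hxy).
      assert (hbx := Rle_trans _ _ _ (re_le_Cmod (x, y)) hb).
      assert (hby := Rle_trans _ _ _ (im_le_Cmod (x, y)) hb).
      simpl in hbx, hby. apply Rabs_le_between in hbx. apply Rabs_le_between in hby.
      apply (hdd x y hbx hby). intros [u [v [_ [_ [h1 [h2 h3]]]]]].
      assert (h := hdelta u v x y h1 h2 hxy). lra.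
Qed.

(** * The distinguished root of the quartic *)

Definition quartic (u w T : C) : C := (T ^ 4 + 2 * u * T + w)%C.

Definition region (u T : C) : Prop :=
  - Re T < 2 * Im T < Re T /\ 0 < Re (2 * T ^ 3 + u)%C.

Definition closed_region (u T : C) : Prop :=
  - Re T <= 2 * Im T <= Re T /\ 0 <= Re (2 * T ^ 3 + u)%C.

Definition kn_weight (z : C) : R := Cmod z ^ 8 + 15 / 7 * Cmod z ^ 2 * Re (z ^ 6)%C.

Lemma Re_cube (T u : C) :
  Re (2 * T ^ 3 + u)%C = 2 * (Re T ^ 3 - 3 * Re T * Im T ^ 2) + Re u.
Proof. destruct T, u; simpl; ring. Qed.

Lemma Re_quartic (u w T : C) :
  Re (quartic u w T) = Re T ^ 4 - 6 * Re T ^ 2 * Im T ^ 2 + Im T ^ 4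
                       + 2 * (Re u * Re T - Im u * Im T) + Re w.
Proof. destruct T, u, w; unfold quartic; simpl; ring. Qed.

Lemma pow6_parts (z : C) :
  Re (z ^ 6)%C ^ 2 + Im (z ^ 6)%C ^ 2 = (Cmod z ^ 2) ^ 6.
Proof. rewrite <- Cmod2_alt, Cmod_pow. ring. Qed.

Lemma region_boundary (z w T : C) :
  closed_region (z ^ 6) T -> ~ region (z ^ 6) T ->
  Re (quartic (z ^ 6) w T) <= Re w + kn_weight z - Cmod z ^ 8 / 100.
Proof.
  intros [[h1 h2] h3] hn. rewrite Re_quartic.
  assert (ht := pow2_ge_0 (Cmod z)).
  assert (h : 2 * Im T = Re T \/ 2 * Im T = - Re T
              \/ 2 * (Re T ^ 3 - 3 * Re T * Im T ^ 2) + Re (z ^ 6)%C = 0).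
  { apply NNPP. intros hh. apply hn. rewrite Re_cube in h3.
    assert (2 * Im T <> Re T) by tauto. assert (2 * Im T <> - Re T) by tauto.
    split; [lra|]. rewrite Re_cube. lra. }
  rewrite Re_cube in h3.
  assert (hb := boundary_ineq _ _ _ _ _ ht (pow6_parts z) h2 h1 h3 h).
  unfold kn_weight.
  replace (Cmod z ^ 8) with ((Cmod z ^ 2) ^ 4) by ring. lra.
Qed.

Lemma Re_rot (a b : R) (T : C) : Re ((a, b) * T)%C = a * Re T - b * Im T.
Proof. destruct T; simpl; ring. Qed.

Lemma ccont_lin (a T : C) : ccont (U := C_UniformSpace) (fun y => a * y)%C T.
Proof. apply ccont_mult; [apply ccont_const|apply ccont_id]. Qed.

Lemma ccont_cube (u T : C) :
  ccont (U := C_UniformSpace) (fun T => 2 * T ^ 3 + u)%C T.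
Proof.
  apply ccont_plus; [|apply ccont_const].
  apply ccont_mult; [apply ccont_const|apply ccont_pow, ccont_id].
Qed.

Lemma ccont_quartic (u w T : C) : ccont (U := C_UniformSpace) (quartic u w) T.
Proof.
  unfold quartic. repeat apply ccont_plus;
    [apply ccont_pow, ccont_id|apply ccont_lin|apply ccont_const].
Qed.

Lemma region_open (u T : C) : region u T -> locally (T := C_UniformSpace) T (region u).
Proof.
  intros [h1 h2].
  generalize (ccont_Re_gt _ T 0 (ccont_lin (1, 2) T) ltac:(rewrite Re_rot; lra)).
  generalize (ccont_Re_gt _ T 0 (ccont_lin (1, -2) T) ltac:(rewrite Re_rot; lra)).
  generalize (ccont_Re_gt _ T 0 (ccont_cube u T) h2).
  intros k1 k2 k3. generalize (filter_and _ _ k1 (filter_and _ _ k2 k3)).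
  apply filter_imp. intros y [h3 [h4 h5]].
  rewrite Re_rot in h4, h5. split; [lra|assumption].
Qed.

Lemma closed_region_closed (u T : C) :
  ~ closed_region u T -> locally (T := C_UniformSpace) T (fun T => ~ closed_region u T).
Proof.
  intros hn.
  destruct (Rlt_dec (2 * Im T) (- Re T)) as [h|h1].
  { generalize (ccont_Re_gt _ T 0 (ccont_lin (-1, 2) T) ltac:(rewrite Re_rot; lra)).
    apply filter_imp. intros y hy. rewrite Re_rot in hy. unfold closed_region. lra. }
  destruct (Rlt_dec (Re T) (2 * Im T)) as [h|h2].
  { generalize (ccont_Re_gt _ T 0 (ccont_lin (-1, -2) T) ltac:(rewrite Re_rot; lra)).
    apply filter_imp. intros y hy. rewrite Re_rot in hy. unfold closed_region. lra. }
  destruct (Rlt_dec (Re (2 * T ^ 3 + u)%C) 0) as [h|h3].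
  - generalize (ccont_Re_gt _ T 0 (ccont_opp _ T (ccont_cube u T))).
    intros hh. generalize (hh ltac:(unfold Re in *; simpl in *; lra)).
    apply filter_imp. intros y hy [_ hy']. unfold Re in *; simpl in *; lra.
  - exfalso. apply hn. unfold closed_region. lra.
Qed.

(** A damped Newton step, in the role of the open mapping theorem: moving [T] by [h * e] multiplies
    [quartic - Q] by [1 - h], up to an error [h ^ 2 * M]. *)
Lemma quartic_decrease (u w Q T : C) (d : R) :
  0 < d -> (4 * T ^ 3 + 2 * u)%C <> 0 -> quartic u w T <> Q ->
  exists T', Cmod (T' - T) < d /\ Cmod (quartic u w T' - Q) < Cmod (quartic u w T - Q).
Proof.
  intros hd hl hQ.
  set (D := (quartic u w T - Q)%C). set (e := (- D / (4 * T ^ 3 + 2 * u))%C).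
  assert (hD : 0 < Cmod D).
  { apply Cmod_gt_0. intros h. apply hQ. unfold D in h.
    replace (quartic u w T) with (quartic u w T - Q + Q)%C by ring. rewrite h. ring. }
  set (r := Cmod e). set (s := Cmod T).
  assert (hr : 0 <= r) by apply Cmod_ge_0. assert (hs : 0 <= s) by apply Cmod_ge_0.
  set (M := 6 * s ^ 2 * r ^ 2 + 4 * s * r ^ 3 + r ^ 4).
  assert (hM : 0 <= M).
  { assert (0 <= r ^ 2) by apply pow2_ge_0. assert (0 <= r ^ 3) by now apply pow_le.
    assert (0 <= s ^ 2) by apply pow2_ge_0. assert (0 <= r ^ 4) by now apply pow_le.
    unfold M. repeat apply Rplus_le_le_0_compat; repeat apply Rmult_le_pos; lra. }
  (* The bounds keep [h] below 1, the displacement below [d], and the error below half of the gain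
     [h * |D|]. *)
  set (h := Rmin (1 / 2) (Rmin (d / (2 * (r + 1))) (Cmod D / (2 * (M + 1))))).
  assert (h0 : 0 < h).
  { apply Rmin_case; [lra|]. apply Rmin_case; apply Rdiv_lt_0_compat; lra. }
  assert (h1 : h <= 1 / 2) by apply Rmin_l.
  assert (h2 : h * (2 * (r + 1)) <= d).
  { apply Rle_trans with (d / (2 * (r + 1)) * (2 * (r + 1))); [|right; field; lra].
    apply Rmult_le_compat_r; [lra|].
    eapply Rle_trans; [apply Rmin_r|apply Rmin_l]. }
  assert (h3 : h * (2 * (M + 1)) <= Cmod D).
  { apply Rle_trans with (Cmod D / (2 * (M + 1)) * (2 * (M + 1))); [|right; field; lra].
    apply Rmult_le_compat_r; [lra|].
    eapply Rle_trans; [apply Rmin_r|apply Rmin_r]. }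
  clearbody h.
  exists (T + h * e)%C. split.
  - replace (T + h * e - T)%C with (h * e)%C by ring.
    rewrite Cmod_mult, Cmod_R, Rabs_pos_eq by lra. fold r. nra.
  - replace (quartic u w (T + h * e) - Q)%C
      with ((1 - h) * D + h * h * (6 * T ^ 2 * e ^ 2 + h * (4 * T * e ^ 3) + h * h * e ^ 4))%C
      by (unfold e, D, quartic; field; assumption).
    eapply Rle_lt_trans; [apply Cmod_triangle|].
    assert (hE : Cmod (6 * T ^ 2 * e ^ 2 + h * (4 * T * e ^ 3) + h * h * e ^ 4)%C <= M).
    { eapply Rle_trans; [apply Cmod_triangle|].
      eapply Rle_trans; [apply Rplus_le_compat_r, Cmod_triangle|].
      rewrite !Cmod_mult, !Cmod_pow, !Cmod_R. fold r s.
      rewrite !Rabs_pos_eq by lra.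
      assert (0 <= 4 * s * r ^ 3)
        by (repeat apply Rmult_le_pos; try apply pow_le; lra).
      assert (0 <= r ^ 4) by (apply pow_le; lra).
      assert (h * (4 * s * r ^ 3) <= 1 * (4 * s * r ^ 3)) by (apply Rmult_le_compat_r; lra).
      assert (h * h * r ^ 4 <= 1 * r ^ 4) by (apply Rmult_le_compat_r; nra).
      unfold M. lra. }
    replace (1 - h)%C with (RtoC (1 - h)) by (rewrite RtoC_minus; reflexivity).
    rewrite !Cmod_mult, !Cmod_R, !Rabs_pos_eq by lra.
    assert (h * h * Cmod (6 * T ^ 2 * e ^ 2 + h * (4 * T * e ^ 3) + h * h * e ^ 4)%C
            <= h * h * M) by (apply Rmult_le_compat_l; nra).
    nra.
Qed.

Lemma region_derivative (u T : C) : region u T -> 0 < Re (4 * T ^ 3 + 2 * u)%C.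
Proof.
  intros [_ h]. replace (4 * T ^ 3 + 2 * u)%C with (2 * (2 * T ^ 3 + u))%C by ring.
  unfold Re in *; simpl in *; lra.
Qed.

Lemma Re_pos_neq0 (z : C) : 0 < Re z -> z <> 0.
Proof. intros h ->. simpl in h. lra. Qed.

Lemma quartic_bound (u w Q T : C) (B : R) :
  Cmod (quartic u w T - Q) <= B ->
  Cmod T <= 1 + (2 * Cmod u + Cmod w + Cmod Q + B).
Proof.
  intros hB. assert (h0 := Cmod_ge_0 (quartic u w T - Q)).
  set (r := Cmod T).
  assert (hu := Cmod_ge_0 u). assert (hw := Cmod_ge_0 w). assert (hQ := Cmod_ge_0 Q).
  assert (hr : 0 <= r) by apply Cmod_ge_0.
  destruct (Rle_dec r 1); [lra|].
  assert (h : r ^ 4 <= B + 2 * Cmod u * r + Cmod w + Cmod Q).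
  { unfold r at 1. rewrite <- Cmod_pow.
    replace (T ^ 4)%C with ((quartic u w T - Q) + - (2 * u * T) + - w + Q)%C
      by (unfold quartic; ring).
    eapply Rle_trans; [apply Cmod_triangle|]. apply Rplus_le_compat_r.
    eapply Rle_trans; [apply Cmod_triangle|]. rewrite Cmod_opp. apply Rplus_le_compat_r.
    eapply Rle_trans; [apply Cmod_triangle|]. rewrite Cmod_opp, !Cmod_mult, Cmod_R.
    rewrite Rabs_pos_eq by lra. fold r. lra. }
  set (S := 2 * Cmod u + Cmod w + Cmod Q + B) in *.
  assert (h' : r * r ^ 3 <= r * S) by (unfold S; nra).
  apply Rmult_le_reg_l in h'; [|lra]. nra.
Qed.

(* A minimum of [|quartic - Q'|] over the closed region cannot lie on its boundary, where
   [Re quartic <= - eta], and at an interior point the nonzero derivative allows descent. *)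
Lemma attain_step (u w Q Q' : C) (eta : R) :
  (forall T, closed_region u T -> ~ region u T -> Re (quartic u w T) <= - eta) ->
  0 <= Re Q' -> Cmod (Q - Q') < eta ->
  (exists T, region u T /\ quartic u w T = Q) ->
  exists T, region u T /\ quartic u w T = Q'.
Proof.
  intros hbd hQ' hlt [T0 [hT0 hq0]].
  destruct (closed_bounded_min
    (fun T => closed_region u T /\ Cmod (quartic u w T - Q') <= Cmod (Q - Q'))
    (fun T => quartic u w T - Q')%C
    (1 + (2 * Cmod u + Cmod w + Cmod Q' + Cmod (Q - Q')))) as [T [[h1 h2] h3]].
  - intros T [_ h]. now apply quartic_bound.
  - intros T hT.
    destruct (classic (closed_region u T)) as [hc|hc].
    + assert (hg : Cmod (Q - Q') < Cmod (quartic u w T - Q'))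
        by (apply Rnot_le_lt; tauto).
      generalize (ccont_Cmod_gt _ T _
        (ccont_minus _ _ T (ccont_quartic u w T) (ccont_const Q' T)) hg).
      apply filter_imp. intros y hy [_ hy']. lra.
    + generalize (closed_region_closed u T hc). apply filter_imp. tauto.
  - intros T. apply ccont_minus; [apply ccont_quartic|apply ccont_const].
  - exists T0. rewrite hq0. split; [|lra].
    destruct hT0; split; lra.
  - assert (hr : region u T).
    { apply NNPP. intros hn. assert (h := hbd T h1 hn).
      assert (h' := re_le_Cmod (quartic u w T - Q')).
      assert (h'' := Rle_abs (- Re (quartic u w T - Q')%C)). rewrite Rabs_Ropp in h''.
      replace (Re (quartic u w T - Q')%C) with (Re (quartic u w T) - Re Q') in *
        by (unfold Re; simpl; ring).
      lra. }
    exists T. split; [assumption|]. apply NNPP. intros hne.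
    destruct (region_open u T hr) as [d hd].
    destruct (quartic_decrease u w Q' T d (cond_pos d)
                (Re_pos_neq0 _ (region_derivative u T hr)) hne) as [T' [h4 h5]].
    assert (hr' : region u T').
    { apply hd. split.
      - exact (Rle_lt_trans _ _ _ (re_le_Cmod (T' - T)) h4).
      - exact (Rle_lt_trans _ _ _ (im_le_Cmod (T' - T)) h4). }
    assert (h6 := h3 T'). assert (closed_region u T') by (destruct hr'; split; lra).
    assert (Cmod (quartic u w T' - Q') <= Cmod (Q - Q')) by lra.
    specialize (h6 (conj H H0)). lra.
Qed.

(* Moves the value from [Q] to [0] along the segment, by steps shorter than [eta]. *)
Lemma attain_zero (u w Q : C) (eta : R) :
  (forall T, closed_region u T -> ~ region u T -> Re (quartic u w T) <= - eta) ->
  0 < eta -> 0 <= Re Q ->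
  (exists T, region u T /\ quartic u w T = Q) ->
  exists T, region u T /\ quartic u w T = 0.
Proof.
  intros hbd heta hQ hT.
  destruct (nfloor_ex (Cmod Q / eta)) as [n [_ hn]].
  { apply Rdiv_le_0_compat; [apply Cmod_ge_0|assumption]. }
  set (N := INR n + 1) in *.
  assert (hN : 0 < N) by (unfold N; generalize (pos_INR n); lra).
  assert (hstep : Cmod Q / N < eta).
  { apply Rmult_lt_reg_r with N; [assumption|].
    replace (Cmod Q / N * N) with (Cmod Q / eta * eta) by (field; lra). nra. }
  assert (hind : forall m, (m <= S n)%nat ->
            exists T, region u T /\ quartic u w T = ((1 - INR m / N)%R * Q)%C).
  { induction m as [|m IH]; intros hm.
    - destruct hT as [T [h1 h2]]. exists T. split; [assumption|].
      rewrite h2. simpl. replace (1 - 0 / N) with 1 by (field; lra). ring.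
    - apply (attain_step u w ((1 - INR m / N)%R * Q)%C _ eta hbd).
      + assert (INR (S m) <= N) by (unfold N; rewrite <- S_INR; now apply le_INR).
        assert (INR (S m) / N <= 1).
        { apply Rmult_le_reg_r with N; [assumption|].
          replace (INR (S m) / N * N) with (INR (S m)) by (field; lra). lra. }
        replace (Re ((1 - INR (S m) / N)%R * Q)%C) with ((1 - INR (S m) / N) * Re Q)
          by (unfold Re; simpl; ring).
        apply Rmult_le_pos; lra.
      + replace ((1 - INR m / N)%R * Q - (1 - INR (S m) / N)%R * Q)%C
          with (RtoC (/ N) * Q)%C.
        * rewrite Cmod_mult, Cmod_R, Rabs_pos_eq; [unfold Rdiv in hstep; lra|].
          left. now apply Rinv_0_lt_compat.
        * rewrite S_INR. replace (/ N) with ((1 - INR m / N) - (1 - (INR m + 1) / N))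
            by (field; lra).
          rewrite (RtoC_minus (1 - INR m / N)). ring.
      + apply IH. lia. }
  destruct (hind (S n) (le_n _)) as [T [h1 h2]]. exists T. split; [assumption|].
  rewrite h2, S_INR. fold N. replace (1 - N / N) with 0 by (field; lra). ring.
Qed.

Lemma quartic_root_exists (z w : C) :
  Re w + kn_weight z - Cmod z ^ 8 / 100 < 0 ->
  exists T, region (z ^ 6) T /\ quartic (z ^ 6) w T = 0.
Proof.
  intros hz.
  (* A real number this large lies in the region and gives the quartic a nonnegative real part: the
     start of the path to the value 0. *)
  set (X := 2 + Rabs (Re (z ^ 6)%C) + Rabs (Re w)).
  assert (hu := Rabs_pos (Re (z ^ 6)%C)). assert (hw := Rabs_pos (Re w)).
  assert (hu' := Rle_abs (- Re (z ^ 6)%C)). assert (hw' := Rle_abs (- Re w)).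
  rewrite Rabs_Ropp in hu', hw'.
  assert (hX : 2 <= X) by (unfold X; lra).
  assert (ha : - (X - 2) <= Re (z ^ 6)%C) by (unfold X; lra).
  assert (hb : - (X - 2) <= Re w) by (unfold X; lra).
  clearbody X. clear hu hw hu' hw'.
  assert (hX2 : 2 * X <= X * X) by nra.
  assert (hX3 : 2 * (X * X) <= X * (X * X)) by nra.
  assert (hX4 : 4 * (X * X) <= X * (X * (X * X))) by nra.
  apply (attain_zero (z ^ 6) w (quartic (z ^ 6) w X) (- (Re w + kn_weight z - Cmod z ^ 8 / 100))).
  - intros T h1 h2. assert (h := region_boundary z w T h1 h2). lra.
  - lra.
  - rewrite Re_quartic.
    assert (0 <= X * (Re (z ^ 6)%C + (X - 2))) by (apply Rmult_le_pos; lra).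
    set (a := Re (z ^ 6)%C) in *. simpl. lra.
  - exists (RtoC X). split; [|reflexivity]. split; [simpl; lra|].
    rewrite Re_cube. set (a := Re (z ^ 6)%C) in *. simpl. lra.
Qed.

(** * Injectivity of the quartic on the region *)

(** A Garding inequality: [x ^ 3 - 3 x y ^ 2 = Re T ^ 3] is a hyperbolic cubic whose cone contains
    the sector, so a lower bound [c] at [a] and at [b] passes to the polar form [Re (a ^ 2 b)]. In
    terms of the slopes [p], [r], the excess over the weighted mean of [A] and [B] is a multiple of
    [(p - r) ^ 2]. *)
Lemma polar_cube (x1 y1 x2 y2 c : R) :
  - x1 < 2 * y1 < x1 -> - x2 < 2 * y2 < x2 ->
  c <= x1 ^ 3 - 3 * x1 * y1 ^ 2 -> c <= x2 ^ 3 - 3 * x2 * y2 ^ 2 ->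
  c <= (x1 ^ 2 - y1 ^ 2) * x2 - 2 * x1 * y1 * y2.
Proof.
  intros h1 h2 hc1 hc2.
  assert (hx1 : 0 < x1) by lra. assert (hx2 : 0 < x2) by lra.
  set (p := y1 / x1). set (r := y2 / x2). set (l := x2 / x1).
  assert (ey1 : y1 = x1 * p) by (unfold p; field; lra).
  assert (ex2 : x2 = x1 * l) by (unfold l; field; lra).
  assert (ey2 : y2 = x1 * l * r) by (unfold r, l; field; lra).
  assert (hl : 0 < l) by (apply Rdiv_lt_0_compat; lra).
  clearbody p r l. subst.
  assert (hp : -1 < 2 * p < 1) by (split; apply Rmult_lt_reg_l with x1; lra).
  assert (hr : -1 < 2 * r < 1) by (split; apply Rmult_lt_reg_l with (x1 * l); lra).
  set (A := 1 - 3 * p ^ 2). set (B := 1 - 3 * r ^ 2).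
  assert (hA : 0 < A) by (unfold A; nra). assert (hB : 0 < B) by (unfold B; nra).
  assert (h3 : 0 < x1 ^ 3) by (apply pow_lt; lra).
  assert (hc1' : c <= x1 ^ 3 * A) by (unfold A; lra).
  assert (hc2' : c <= x1 ^ 3 * (l ^ 3 * B)) by (unfold B; lra).
  apply Rle_trans with (x1 ^ 3 * (l * ((2 * A + B) / 3))).
  - destruct (Rle_dec c 0) as [h0|h0].
    + apply Rle_trans with 0; [assumption|]. left.
      repeat apply Rmult_lt_0_compat; lra.
    + (* AM-GM: [2 l + 1 / l ^ 2 >= 3] *)
      assert (hl2 : 0 < l ^ 2) by (apply pow_lt; lra).
      apply Rmult_le_reg_l with (3 * l ^ 2); [lra|].
      assert (k1 : c * (2 * l ^ 3) <= x1 ^ 3 * A * (2 * l ^ 3)).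
      { apply Rmult_le_compat_r; [|assumption].
        assert (0 < l ^ 3) by (apply pow_lt; lra). lra. }
      assert (k2 : 0 <= c * ((l - 1) ^ 2 * (2 * l + 1))).
      { apply Rmult_le_pos; [lra|]. apply Rmult_le_pos; [apply pow2_ge_0|lra]. }
      lra.
  - assert (0 <= x1 ^ 3 * l * (p - r) ^ 2).
    { apply Rmult_le_pos; [|apply pow2_ge_0]. left. now apply Rmult_lt_0_compat. }
    unfold A, B. lra.
Qed.

(** The divided difference of the quartic in [T], as a polynomial: at [a = b] it is the
    derivative. *)
Definition secant (u a b : C) : C := (a ^ 3 + a ^ 2 * b + a * b ^ 2 + b ^ 3 + 2 * u)%C.

Lemma secant_spec (u w a b : C) :
  ((a - b) * secant u a b)%C = (quartic u w a - quartic u w b)%C.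
Proof. unfold secant, quartic. ring. Qed.

(** With [c = - Re u / 2], the region gives [Re a ^ 3 >= c] and [Re b ^ 3 >= c], and polarization
    gives the same for the two mixed terms; only [Re a ^ 3] is kept exactly. Hence the quartic is
    injective on the region, with a bound independent of [b], as continuity of the root requires. *)
Lemma secant_lower (u a b : C) : region u a -> region u b ->
  Re (2 * a ^ 3 + u)%C / 2 <= Re (secant u a b).
Proof.
  intros [ha1 ha2] [hb1 hb2]. rewrite Re_cube in *.
  assert (h1 := polar_cube _ _ _ _ (- Re u / 2) ha1 hb1 ltac:(lra) ltac:(lra)).
  assert (h2 := polar_cube _ _ _ _ (- Re u / 2) hb1 ha1 ltac:(lra) ltac:(lra)).
  replace (Re (secant u a b)) with
    ((Re a ^ 3 - 3 * Re a * Im a ^ 2) + (Re b ^ 3 - 3 * Re b * Im b ^ 2)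
     + ((Re a ^ 2 - Im a ^ 2) * Re b - 2 * Re a * Im a * Im b)
     + ((Re b ^ 2 - Im b ^ 2) * Re a - 2 * Re b * Im b * Im a) + 2 * Re u)
    by (destruct a, b, u; unfold secant; simpl; ring).
  lra.
Qed.

(** * Regularity of implicitly defined functions *)

Lemma ccont_quotient {U : UniformSpace} (f g q : U -> C) (x : U) (m : R) :
  0 < m -> ccont g x ->
  locally x (fun y => ((f y - f x) * q y)%C = (g y - g x)%C /\ m <= Cmod (q y)) ->
  ccont f x.
Proof.
  intros hm hg hl eps heps.
  assert (he : 0 < eps * m) by now apply Rmult_lt_0_compat.
  generalize (filter_and _ _ (hg _ he) hl). apply filter_imp. intros y [h1 [h2 h3]].
  rewrite <- h2, Cmod_mult in h1. apply Rmult_lt_reg_r with m; [assumption|].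
  eapply Rle_lt_trans; [|exact h1]. apply Rmult_le_compat_l; [apply Cmod_ge_0|assumption].
Qed.

Lemma ccont_of_diff {U : NormedModule C_AbsRing} (f : U -> C) (x : U) :
  ex_filterdiff (K := C_AbsRing) (V := C_NormedModule) f (locally x) -> ccont f x.
Proof.
  intros hf eps heps.
  assert (hc := filterdiff_continuous_aux (V := C_NormedModule) f hf x (fun P h => h)).
  exact (hc _ (ccont_id (f x) eps heps)).
Qed.

(** Implicit differentiation from a relation between increments; the derivative is that of [g]
    divided by [q x]. It serves for the root of the quartic, for reciprocals and for fourth
    roots. *)
Lemma ex_filterdiff_quotient {U : NormedModule C_AbsRing} (f g q : U -> C) (x : U) :
  ex_filterdiff (K := C_AbsRing) (V := C_NormedModule) g (locally x) ->
  ccont q x -> q x <> 0 ->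
  locally x (fun y => ((f y - f x) * q y)%C = (g y - g x)%C) ->
  ex_filterdiff (K := C_AbsRing) (V := C_NormedModule) f (locally x).
Proof.
  intros [l [hl hd]] hq hq0 heq.
  destruct hl as [l1 l2 [M [hM l3]]].
  assert (hqx : 0 < Cmod (q x)) by now apply Cmod_gt_0.
  exists (fun v => (l v / q x)%C). split.
  - constructor.
    + intros a b. rewrite l1. change ((l a + l b) / q x = l a / q x + l b / q x)%C. field.
      assumption.
    + intros k a. rewrite l2. change ((k * l a) / q x = k * (l a / q x))%C. field. assumption.
    + exists (M / Cmod (q x)). split; [now apply Rdiv_lt_0_compat|]. intros a.
      change (Cmod (l a / q x) <= M / Cmod (q x) * norm a).
      rewrite Cmod_div by assumption. specialize (l3 a).
      change (Cmod (l a) <= M * norm a) in l3.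
      unfold Rdiv. replace (M * / Cmod (q x) * norm a) with (M * norm a * / Cmod (q x)) by ring.
      apply Rmult_le_compat_r; [|assumption]. left. now apply Rinv_0_lt_compat.
  - intros x0 hx0.
    assert (x0 = x) by (symmetry; now apply is_filter_lim_locally_unique).
    subst x0. intros eps.
    set (Q := Cmod (q x)) in *.
    assert (he1 : 0 < eps * Q / 4)
      by (apply Rdiv_lt_0_compat; [apply Rmult_lt_0_compat; [apply cond_pos|assumption]|lra]).
    assert (he2 : 0 < Rmin (Q / 2) (eps * Q * Q / (4 * M))).
    { apply Rmin_case; [lra|]. apply Rdiv_lt_0_compat; [|lra].
      repeat apply Rmult_lt_0_compat; try assumption. apply cond_pos. }
    generalize (filter_and _ _ (hd x hx0 (mkposreal _ he1))
                  (filter_and _ _ (hq _ he2) heq)).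
    apply filter_imp. intros y [h1 [h2 h3]].
    change (Cmod (g y - g x - l (minus y x)) <= eps * Q / 4 * norm (minus y x)) in h1.
    change (Cmod (f y - f x - l (minus y x) / q x) <= eps * norm (minus y x)).
    specialize (l3 (minus y x)).
    change (Cmod (l (minus y x)) <= M * norm (minus y x)) in l3.
    set (v := minus y x) in *. set (n := norm v) in *.
    assert (hn : 0 <= n) by apply norm_ge_0.
    assert (h4 := Rlt_le_trans _ _ _ h2 (Rmin_l _ _)).
    assert (h5 := Rlt_le_trans _ _ _ h2 (Rmin_r _ _)).
    assert (h6 : Q / 2 <= Cmod (q y)).
    { assert (h := Cmod_triangle (q y) (- (q y - q x))). rewrite Cmod_opp in h.
      replace (q y + - (q y - q x))%C with (q x) in h by ring. fold Q in h. lra. }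
    assert (hqy : q y <> 0) by (apply Cmod_gt_0; lra).
    apply Rmult_le_reg_r with (Cmod (q y)); [lra|].
    rewrite <- Cmod_mult.
    (* Multiplied by [q y], the remainder of [f] becomes the remainder of [g] and a term carrying
       [q y - q x]; each is at most [eps * Q / 4 * n], and [Q / 2 <= |q y|] pays for dividing
       back. *)
    replace ((f y - f x - l v / q x) * q y)%C
      with ((g y - g x - l v) + - ((q y - q x) * l v / q x))%C
      by (rewrite <- h3; field; assumption).
    eapply Rle_trans; [apply Cmod_triangle|].
    rewrite Cmod_opp, Cmod_div, Cmod_mult by assumption. fold Q.
    apply Rle_trans with (eps * Q / 4 * n + eps * Q / 4 * n).
    + apply Rplus_le_compat; [assumption|].
      apply Rmult_le_reg_r with Q; [assumption|].
      replace (Cmod (q y - q x) * Cmod (l v) / Q * Q) with (Cmod (q y - q x) * Cmod (l v))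
        by (field; lra).
      apply Rle_trans with (eps * Q * Q / (4 * M) * (M * n)).
      * apply Rmult_le_compat; try apply Cmod_ge_0; lra.
      * right. field. lra.
    + apply Rle_trans with (eps * n * (Q / 2)); [right; field|].
      apply Rmult_le_compat_l; [|assumption].
      apply Rmult_le_pos; [left; apply cond_pos|assumption].
Qed.

Lemma ex_filterdiff_Cplus {U : NormedModule C_AbsRing} (f g : U -> C) (x : U) :
  ex_filterdiff (K := C_AbsRing) (V := C_NormedModule) f (locally x) ->
  ex_filterdiff (K := C_AbsRing) (V := C_NormedModule) g (locally x) ->
  ex_filterdiff (K := C_AbsRing) (V := C_NormedModule) (fun y => f y + g y)%C (locally x).
Proof. intros hf hg. exact (ex_filterdiff_plus_fct f g hf hg). Qed.

Lemma ex_filterdiff_Cconst {U : NormedModule C_AbsRing} (c : C) (x : U) :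
  ex_filterdiff (K := C_AbsRing) (V := C_NormedModule) (fun _ : U => c) (locally x).
Proof. apply ex_filterdiff_const. Qed.

Lemma ex_filterdiff_Cscal {U : NormedModule C_AbsRing} (c : C) (f : U -> C) (x : U) :
  ex_filterdiff (K := C_AbsRing) (V := C_NormedModule) f (locally x) ->
  ex_filterdiff (K := C_AbsRing) (V := C_NormedModule) (fun y => c * f y)%C (locally x).
Proof.
  intros hf. exact (ex_filterdiff_scal_r_fct c f Cmult_comm hf).
Qed.

Lemma ex_filterdiff_Cmult {U : NormedModule C_AbsRing} (f g : U -> C) (x : U) :
  ex_filterdiff (K := C_AbsRing) (V := C_NormedModule) f (locally x) ->
  ex_filterdiff (K := C_AbsRing) (V := C_NormedModule) g (locally x) ->
  ex_filterdiff (K := C_AbsRing) (V := C_NormedModule) (fun y => f y * g y)%C (locally x).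
Proof.
  intros [l [[l1 l2 l3] hl]] hg.
  (* [ex_filterdiff_scal_fct] expects the scalar factor in this other module structure on [C]; the
     derivative transfers because the norms agree. *)
  assert (hf : ex_filterdiff (K := C_AbsRing) (V := AbsRing_NormedModule C_AbsRing)
                 f (locally x)).
  { exists l. split; [|exact hl]. constructor; [exact l1|exact l2|exact l3]. }
  exact (ex_filterdiff_scal_fct (V := C_NormedModule) x f g Cmult_comm hf hg).
Qed.

(** * Holomorphic dependence of the root on the point *)

Notation diff_at f x := (ex_filterdiff (K := C_AbsRing) (V := C_NormedModule) f (locally x)).

(* The slack [|z|^8 / 100] puts the boundary points with [z <> 0] inside the model. *)
Definition kn_model (z w : C) : Prop := Re w + kn_weight z - Cmod z ^ 8 / 100 < 0.

Definition is_root (z w T : C) : Prop :=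
  region (z ^ 6) T /\ quartic (z ^ 6) w T = 0.

Lemma root_function :
  exists tau : C -> C -> C, forall z w, kn_model z w -> is_root z w (tau z w).
Proof.
  exists (fun z w => epsilon (inhabits (RtoC 0)) (is_root z w)).
  intros z w h. apply epsilon_spec. now apply quartic_root_exists.
Qed.

(** Freezing [T] at the base point on the right makes that side the increment of an explicit
    polynomial in [(z, w)], the form that the quotient lemmas take. *)
Lemma root_increment (z w T z' w' T' : C) :
  is_root z w T -> is_root z' w' T' ->
  ((T' - T) * secant (z' ^ 6) T T')%C
  = (- (2 * z' ^ 6 * T + w') - - (2 * z ^ 6 * T + w))%C.
Proof.
  intros [_ h] [_ h'].
  transitivity ((quartic (z' ^ 6) w' T' - w') - (quartic (z ^ 6) w T - w)
                 - 2 * (z' ^ 6 - z ^ 6) * T)%C.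
  - unfold secant, quartic. ring.
  - rewrite h, h'. ring.
Qed.

Lemma root_ccont {U : UniformSpace} (Z W T : U -> C) (x : U) :
  ccont Z x -> ccont W x -> locally x (fun y => is_root (Z y) (W y) (T y)) ->
  ccont T x.
Proof.
  intros hZ hW hT.
  assert (hx : is_root (Z x) (W x) (T x)) by exact (locally_singleton _ _ hT).
  assert (hl := proj2 (proj1 hx)). set (l := Re (2 * T x ^ 3 + Z x ^ 6)%C) in hl.
  (* For nearby [y] the base root [T x] stays in the moved region with at least [l / 2] in place of
     [l]; [secant_lower] halves this again, whence [l / 4]. *)
  apply (ccont_quotient _ (fun y => - (2 * Z y ^ 6 * T x + W y))%C
           (fun y => secant (Z y ^ 6) (T x) (T y)) x (l / 4)); [lra| |].
  - apply ccont_opp, ccont_plus; [|assumption].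
    apply ccont_mult; [|apply ccont_const].
    apply ccont_mult; [apply ccont_const|now apply ccont_pow].
  - assert (hc : ccont (fun y => 2 * T x ^ 3 + Z y ^ 6)%C x)
      by (apply ccont_plus; [apply ccont_const|now apply ccont_pow]).
    assert (hh : l / 2 < l) by lra.
    generalize (filter_and _ _ hT (ccont_Re_gt _ x _ hc hh)).
    apply filter_imp. intros y [h1 h2]. split; [now apply root_increment|].
    assert (hr : region (Z y ^ 6) (T x)) by (split; [apply hx|lra]).
    assert (h3 := secant_lower _ _ _ hr (proj1 h1)).
    assert (h4 := re_le_Cmod (secant (Z y ^ 6) (T x) (T y))).
    assert (h5 := Rle_abs (Re (secant (Z y ^ 6) (T x) (T y)))). lra.
Qed.

Lemma root_diff {U : NormedModule C_AbsRing} (Z W T : U -> C) (x : U) :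
  diff_at Z x -> diff_at W x -> locally x (fun y => is_root (Z y) (W y) (T y)) ->
  diff_at T x.
Proof.
  intros hZ hW hT.
  assert (hx : is_root (Z x) (W x) (T x)) by exact (locally_singleton _ _ hT).
  assert (hcZ := ccont_of_diff _ _ hZ).
  assert (hcT := root_ccont Z W T x hcZ (ccont_of_diff _ _ hW) hT).
  assert (hZn : forall n, diff_at (fun y => Z y ^ n)%C x).
  { intros n. induction n as [|n IH]; simpl.
    - apply ex_filterdiff_Cconst.
    - now apply ex_filterdiff_Cmult. }
  apply (ex_filterdiff_quotient _ (fun y => (-1) * ((2 * T x) * Z y ^ 6 + W y))%C
           (fun y => secant (Z y ^ 6) (T x) (T y))).
  - apply ex_filterdiff_Cscal, ex_filterdiff_Cplus; [|assumption].
    apply ex_filterdiff_Cscal, hZn.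
  - unfold secant.
    repeat first [apply ccont_plus | apply ccont_mult | apply ccont_const
                 | apply ccont_pow; assumption | assumption].
  - apply Re_pos_neq0. assert (h := secant_lower _ _ _ (proj1 hx) (proj1 hx)).
    assert (h' := proj2 (proj1 hx)). lra.
  - generalize hT. apply filter_imp. intros y hy.
    rewrite (root_increment _ _ _ _ _ _ hx hy). ring.
Qed.

Lemma ex_filterdiff_Cinv {U : NormedModule C_AbsRing} (h : U -> C) (x : U) :
  diff_at h x -> locally x (fun y => h y <> 0) -> diff_at (fun y => / h y)%C x.
Proof.
  intros hd h0. assert (hx := locally_singleton _ _ h0 : h x <> 0).
  apply (ex_filterdiff_quotient _ (fun y => (- / h x) * h y)%C h).
  - now apply ex_filterdiff_Cscal.
  - now apply ccont_of_diff.
  - assumption.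
  - generalize h0. apply filter_imp. intros y hy. field. now split.
Qed.

Lemma Cmod_cone (T : C) : - Re T < 2 * Im T < Re T -> Cmod T <= 2 * Re T.
Proof.
  intros h. eapply Rle_trans; [apply Cmod_le_abs|].
  rewrite (Rabs_pos_eq (Re T)) by lra.
  assert (Rabs (Im T) <= Re T) by (apply Rabs_le; lra). lra.
Qed.

(** If [|z| ^ 2 > 4 Re T], the term [|z| ^ 8] outweighs all that the quartic equation allows for
    [Re w]. The bound lets [T] control [z] and then, through the equation, [w], also at infinity. *)
Lemma root_growth (z w T : C) :
  kn_model z w -> is_root z w T -> Cmod z ^ 2 <= 4 * Re T.
Proof.
  intros hm [[h1 h2] h3]. apply Rnot_lt_le. intros hlt.
  apply (f_equal Re) in h3. rewrite Re_quartic in h3. simpl (Re 0) in h3.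
  rewrite Re_cube in h2.
  unfold kn_model, kn_weight in hm.
  assert (hp := pow6_parts z).
  set (t := Cmod z ^ 2) in *. replace (Cmod z ^ 8) with (t ^ 4) in hm by (unfold t; ring).
  assert (ht : 0 <= t) by apply pow2_ge_0.
  set (a := Re (z ^ 6)%C) in *. set (b := Im (z ^ 6)%C) in *.
  set (x := Re T) in *. set (y := Im T) in *. clearbody t a b x y.
  assert (ht3 : 0 <= t ^ 3) by now apply pow_le.
  assert (ha : a <= t ^ 3) by nra. assert (hb : - t ^ 3 <= b <= t ^ 3) by nra.
  assert (hy : y ^ 2 <= x ^ 2 / 4) by nra.
  assert (hax : a * x <= t ^ 3 * x) by (apply Rmult_le_compat_r; lra).
  assert (hby : - (b * y) <= t ^ 3 * (x / 2)) by nra.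
  assert (hx3 : 0 < x ^ 3) by (apply pow_lt; lra).
  assert (hta : - (2 * (t * x ^ 3)) <= t * a).
  { assert (0 <= t * (2 * (x ^ 3 - 3 * x * y ^ 2) + a)) by (apply Rmult_le_pos; lra).
    assert (0 <= t * (x * y ^ 2))
      by (apply Rmult_le_pos; [lra|apply Rmult_le_pos; [lra|apply pow2_ge_0]]).
    lra. }
  assert (hq : x ^ 4 - 6 * x ^ 2 * y ^ 2 + y ^ 4 <= x ^ 4).
  { assert (0 <= x ^ 2) by apply pow2_ge_0. assert (0 <= y ^ 2) by apply pow2_ge_0.
    replace (y ^ 4) with (y ^ 2 * y ^ 2) by ring. nra. }
  (* In [v] and [x] the polynomial to be shown positive has only positive coefficients. *)
  set (v := t - 4 * x). replace t with (v + 4 * x) in * by (unfold v; ring).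
  assert (hv : 0 < v) by (unfold v in *; lra). clearbody v.
  clear - hm h3 hax hby hta hq hv hlt h1.
  assert (hx : 0 < x) by lra.
  assert (p0 := pow_lt x 4 hx). assert (p4 := pow_lt v 4 hv).
  assert (p1 := Rmult_lt_0_compat _ _ (pow_lt v 1 hv) (pow_lt x 3 hx)).
  assert (p2 := Rmult_lt_0_compat _ _ (pow_lt v 2 hv) (pow_lt x 2 hx)).
  assert (p3 := Rmult_lt_0_compat _ _ (pow_lt v 3 hv) (pow_lt x 1 hx)).
  lra.
Qed.

(** * Fourth roots and a criterion for peak functions *)

Lemma Csqrt_exists (G : C) :
  ~ (Im G = 0 /\ Re G <= 0) -> exists r, (r * r)%C = G /\ 0 < Re r.
Proof.
  intros hG. destruct G as [x y]. simpl in hG.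
  set (m := Cmod (x, y)).
  assert (hm : m ^ 2 = x ^ 2 + y ^ 2) by apply (Cmod2_alt (x, y)).
  assert (hm0 : 0 <= m) by apply Cmod_ge_0.
  assert (hp : 0 < m + x).
  { destruct (Req_dec y 0) as [hy|hy].
    - assert (0 < x) by (apply Rnot_le_lt; tauto). lra.
    - assert (0 < y ^ 2) by (apply pow2_gt_0; assumption). nra. }
  set (a := sqrt ((m + x) / 2)).
  assert (ha : 0 < a) by (apply sqrt_lt_R0; lra).
  assert (ha2 : a * a = (m + x) / 2) by (apply sqrt_sqrt; lra).
  exists (a, y / (2 * a)). split; [|assumption].
  unfold Cmult; simpl. f_equal.
  - apply Rmult_eq_reg_r with (4 * (a * a)); [|nra].
    replace ((a * a - y / (2 * a) * (y / (2 * a))) * (4 * (a * a)))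
      with (4 * (a * a) * (a * a) - y ^ 2) by (field; lra).
    rewrite ha2. nra.
  - field. lra.
Qed.

(** The two positivity conditions say [|arg r| < pi / 4]. There the real part dominates the modulus,
    whereas a square root on the slit plane only has a positive real part. *)
Lemma Croot4_exists (G : C) :
  ~ (Im G = 0 /\ Re G <= 0) -> exists r, (r ^ 4)%C = G /\ 0 < Re r /\ 0 < Re (r ^ 2)%C.
Proof.
  intros hG. destruct (Csqrt_exists G hG) as [a [ha1 ha2]].
  destruct (Csqrt_exists a) as [r [hr1 hr2]]; [lra|].
  exists r. split; [|split].
  - rewrite <- ha1, <- hr1. ring.
  - assumption.
  - replace (r ^ 2)%C with (r * r)%C by ring. now rewrite hr1.
Qed.

(** The difference of fourth powers is the increment of [r] times [q], and on the chosen branch both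
    factors of [q] have real part bounded below by their contribution at [x]. *)
Lemma Croot4_diff {U : NormedModule C_AbsRing} (G r : U -> C) (x : U) :
  diff_at G x ->
  locally x (fun y => (r y ^ 4)%C = G y /\ 0 < Re (r y) /\ 0 < Re (r y ^ 2)%C) ->
  diff_at r x.
Proof.
  intros hG hr. destruct (locally_singleton _ _ hr) as [hx1 [hx2 hx3]].
  set (q := fun y => ((r y + r x) * (r y ^ 2 + r x ^ 2))%C).
  assert (hinc : locally x (fun y => ((r y - r x) * q y)%C = (G y - G x)%C)).
  { generalize hr. apply filter_imp. intros y [h _]. rewrite <- h, <- hx1. unfold q. ring. }
  assert (hc : ccont r x).
  { apply (ccont_quotient r G q x (Re (r x) * Re (r x ^ 2)%C)).
    - now apply Rmult_lt_0_compat.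
    - now apply ccont_of_diff.
    - generalize (filter_and _ _ hr hinc). apply filter_imp.
      intros y [[h1 [h2 h3]] h4]. split; [assumption|].
      unfold q. rewrite Cmod_mult.
      apply Rmult_le_compat; try lra.
      + eapply Rle_trans; [|apply re_le_Cmod]. eapply Rle_trans; [|apply Rle_abs].
        unfold Re in *; simpl in *; lra.
      + eapply Rle_trans; [|apply re_le_Cmod]. eapply Rle_trans; [|apply Rle_abs].
        unfold Re in *; simpl in *; lra. }
  apply (ex_filterdiff_quotient r G q x hG).
  - unfold q. repeat first [apply ccont_plus | apply ccont_mult | apply ccont_const
                 | apply ccont_pow | assumption].
  - unfold q. apply Cmult_neq_0; apply Re_pos_neq0; unfold Re in *; simpl in *; lra.
  - exact hinc.
Qed.

(** Since [|1 + g| >= 1 + Re g], the function [1 / (1 + g)] has modulus at most [1 / (1 + c)] off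
    the ball; [s] is half of the gap to 1, for strictness. *)
Lemma peak_of_real_part {U : NormedModule C_AbsRing} (Omega : U -> Prop) (p : U) (g : U -> C) :
  (forall x, Omega x -> locally x Omega) ->
  holomorphic Omega g ->
  (forall x, Omega x -> 0 <= Re (g x)) ->
  (forall eps, 0 < eps -> within Omega (locally p) (fun x => Cmod (g x) < eps)) ->
  (forall r, 0 < r -> exists c, 0 < c /\
     forall x, Omega x -> ~ norm_ball p r x -> c <= Re (g x)) ->
  exists f, peak_function Omega p f.
Proof.
  intros hO hg hpos hlim hoff.
  assert (hRe : forall x, Re (1 + g x)%C = 1 + Re (g x)) by (intros; reflexivity).
  assert (hle : forall x, Omega x -> 1 + Re (g x) <= Cmod (1 + g x)).
  { intros x hx. rewrite <- hRe. eapply Rle_trans; [apply Rle_abs|apply re_le_Cmod]. }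
  assert (hne : forall x, Omega x -> (1 + g x)%C <> 0).
  { intros x hx. apply Re_pos_neq0. rewrite hRe. specialize (hpos x hx). lra. }
  exists (fun x => / (1 + g x))%C. split; [|split].
  - intros x hx.
    apply ex_filterdiff_Cinv.
    + apply ex_filterdiff_Cplus; [apply ex_filterdiff_Cconst|apply hg, hx].
    + generalize (hO x hx). apply filter_imp. exact hne.
  - intros P [d hP].
    assert (hP' : forall y, Cmod (y - 1) < d -> P y).
    { intros y hy. apply hP. split.
      - exact (Rle_lt_trans _ _ _ (re_le_Cmod (y - 1)) hy).
      - exact (Rle_lt_trans _ _ _ (im_le_Cmod (y - 1)) hy). }
    change (locally p (fun x => Omega x -> P (/ (1 + g x))%C)).
    generalize (hlim d (cond_pos d)). unfold within. apply filter_imp. intros x hx hOx.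
    apply hP'. specialize (hx hOx).
    replace (/ (1 + g x) - 1)%C with (- (g x / (1 + g x)))%C by (field; now apply hne).
    rewrite Cmod_opp, Cmod_div by now apply hne.
    assert (h1 := hle x hOx). assert (h2 := hpos x hOx).
    apply Rmult_lt_reg_r with (Cmod (1 + g x)); [lra|].
    replace (Cmod (g x) / Cmod (1 + g x) * Cmod (1 + g x)) with (Cmod (g x))
      by (field; lra).
    assert (h3 := cond_pos d). nra.
  - intros r hr. destruct (hoff r hr) as [c [hc hcx]].
    exists (c / (2 * (1 + c))). split; [apply Rdiv_lt_0_compat; lra|].
    intros x hx hb. specialize (hcx x hx hb).
    rewrite Cmod_inv by now apply hne. specialize (hle x hx).
    apply Rle_lt_trans with (/ (1 + c)).
    + apply Rinv_le_contravar; lra.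
    + replace (1 - c / (2 * (1 + c))) with (/ (1 + c) * ((2 + c) / 2)) by (field; lra).
      rewrite <- (Rmult_1_r (/ (1 + c))) at 1. apply Rmult_lt_compat_l; [|lra].
      apply Rinv_0_lt_compat. lra.
Qed.

(** * Supporting functions off the axis *)

(** Two directions in the cone differ by at most [2 arctan (1 / 2)], whose cosine is [3 / 5] and
    tangent [4 / 3]; the products give [3 |E| <= 4 D] for the dot product [D] and the cross product
    [E]. *)
Lemma cone_angle (a b : C) :
  - Re a < 2 * Im a < Re a -> - Re b < 2 * Im b < Re b ->
  3 / 5 * (Cmod a * Cmod b) <= Re (a * Cconj b)%C.
Proof.
  intros ha hb. destruct a as [x1 y1], b as [x2 y2]. simpl in ha, hb.
  assert (p1 : 0 < (x1 + 2 * y1) * (x2 + 2 * y2)) by (apply Rmult_lt_0_compat; lra).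
  assert (p2 : 0 < (x1 + 2 * y1) * (x2 - 2 * y2)) by (apply Rmult_lt_0_compat; lra).
  assert (p3 : 0 < (x1 - 2 * y1) * (x2 + 2 * y2)) by (apply Rmult_lt_0_compat; lra).
  assert (p4 : 0 < (x1 - 2 * y1) * (x2 - 2 * y2)) by (apply Rmult_lt_0_compat; lra).
  set (D := x1 * x2 + y1 * y2). set (E := x1 * y2 - x2 * y1).
  assert (h1 : 0 <= 4 * D - 3 * E) by (unfold D, E; lra).
  assert (h2 : 0 <= 4 * D + 3 * E) by (unfold D, E; lra).
  assert (hab : (Cmod (x1, y1) * Cmod (x2, y2)) ^ 2 = D ^ 2 + E ^ 2).
  { rewrite Rpow_mult_distr, !Cmod2_alt. unfold D, E. simpl. ring. }
  replace (Re ((x1, y1) * Cconj (x2, y2))%C) with D by (unfold D; simpl; ring).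
  assert (h0 : 0 <= Cmod (x1, y1) * Cmod (x2, y2))
    by (apply Rmult_le_pos; apply Cmod_ge_0).
  set (m := Cmod (x1, y1) * Cmod (x2, y2)) in *. clearbody m D E. nra.
Qed.

(* [Re (kn_coef z * s ^ 8)] agrees to first order at [s = 1] with [kn_weight (z * s)]. *)
Definition kn_coef (z : C) : C :=
  (kn_weight z, 45 / 28 * Cmod z ^ 2 * Im (z ^ 6)%C).

Lemma kn_gap (z s : C) : z <> 0 -> 14 / 25 * Cmod s ^ 2 <= Re (s ^ 2)%C ->
  Cmod z ^ 8 * (Re (s ^ 2)%C ^ 2 * Im (s ^ 2)%C ^ 2 / 5)
  <= kn_weight (z * s) - Re (kn_coef z * (s ^ 2) ^ 4)%C.
Proof.
  intros hz hs.
  assert (ht : 0 < Cmod z) by now apply Cmod_gt_0.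
  assert (hp := pow6_parts z).
  set (t := Cmod z ^ 2) in *. assert (ht' : 0 < t) by (apply pow_lt; assumption).
  assert (ht3 : 0 < t ^ 3) by (apply pow_lt; assumption).
  assert (hpq := Cmod2_alt (s ^ 2)). rewrite Cmod_pow in hpq.
  assert (hr := pow2_ge_0 (Cmod s)).
  assert (hk : kn_weight (z * s)
    = t ^ 4 * (Cmod s ^ 2) ^ 4
      + 15 / 7 * t * (Cmod s ^ 2) * Re (z ^ 6 * (s ^ 2) ^ 3)%C).
  { unfold kn_weight. rewrite Cmod_mult.
    replace ((z * s) ^ 6)%C with (z ^ 6 * (s ^ 2) ^ 3)%C by ring. unfold t. ring. }
  rewrite hk.
  unfold kn_coef, kn_weight.
  replace (Cmod z ^ 8) with (t ^ 4) by (unfold t; ring). fold t.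
  set (S := (s ^ 2)%C) in *. set (r := Cmod s ^ 2) in *.
  set (e := Re (z ^ 6)%C / t ^ 3). set (f := Im (z ^ 6)%C / t ^ 3).
  assert (he : Re (z ^ 6)%C = t ^ 3 * e) by (unfold e; field; lra).
  assert (hf : Im (z ^ 6)%C = t ^ 3 * f) by (unfold f; field; lra).
  clearbody e f.
  assert (hef : e ^ 2 + f ^ 2 = 1).
  { rewrite he, hf in hp. apply Rmult_eq_reg_l with (t ^ 6); [lra|].
    apply pow_nonzero; lra. }
  assert (h := sector_gap e f _ _ _ hef hr (eq_sym hpq) hs).
  apply (Rmult_le_compat_l (t ^ 4)) in h; [|apply pow_le; lra].
  clearbody t r S.
  set (u := (z ^ 6)%C) in *. clearbody u. destruct u as [u1 u2]. destruct S as [p q].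
  clear hk hp hs hpq hr hef.
  simpl in *. subst u1 u2. lra.
Qed.

(* The vanishing of [quartic] at [T] turns the defining inequality of the domain into
   [Re (T ^ 4 + 2 z ^ 6 T) > kn_weight z]; the quartic at [k s ^ 2] is [kn_coef z0 s ^ 8]. *)
Lemma kn_gap_root (z0 k s w T : C) :
  z0 <> 0 -> is_root z0 (- kn_coef z0) k -> is_root (z0 * s) w T ->
  Re w + kn_weight (z0 * s) < 0 -> 14 / 25 * Cmod s ^ 2 <= Re (s ^ 2)%C ->
  Cmod z0 ^ 8 * (Re (s ^ 2)%C ^ 2 * Im (s ^ 2)%C ^ 2 / 5)
  < Re ((T - k * s ^ 2) * secant ((z0 * s) ^ 6) T (k * s ^ 2))%C.
Proof.
  intros hz [_ hk] [_ hT] hw hs.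
  assert (h := kn_gap z0 s hz hs).
  rewrite (secant_spec _ (w + kn_coef z0 * (s ^ 2) ^ 4)).
  replace (quartic ((z0 * s) ^ 6) (w + kn_coef z0 * (s ^ 2) ^ 4) T
           - quartic ((z0 * s) ^ 6) (w + kn_coef z0 * (s ^ 2) ^ 4) (k * s ^ 2))%C
    with (quartic ((z0 * s) ^ 6) w T - (s ^ 2) ^ 4 * quartic (z0 ^ 6) (- kn_coef z0) k
          - w - kn_coef z0 * (s ^ 2) ^ 4)%C by (unfold quartic; ring).
  rewrite hT, hk.
  replace (0 - (s ^ 2) ^ 4 * 0 - w - kn_coef z0 * (s ^ 2) ^ 4)%C
    with (- w - kn_coef z0 * (s ^ 2) ^ 4)%C by ring.
  replace (Re (- w - kn_coef z0 * (s ^ 2) ^ 4)%C)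
    with (- Re w - Re (kn_coef z0 * (s ^ 2) ^ 4)%C) by (unfold Re; simpl; ring).
  lra.
Qed.

Lemma region_add (u T : C) (x : R) : 0 <= x -> region u T -> region u (T + x)%C.
Proof.
  intros hx [h1 h2]. rewrite Re_cube in h2.
  assert (e1 : Re (T + x)%C = Re T + x) by reflexivity.
  assert (e2 : Im (T + x)%C = Im T) by (unfold Im; simpl; ring).
  split; [rewrite e1, e2; lra|]. rewrite Re_cube, e1, e2.
  set (a := Re T) in *. set (b := Im T) in *. clearbody a b. clear e1 e2.
  assert (b ^ 2 <= a ^ 2 / 4) by nra.
  assert (0 <= x * (3 * a ^ 2 - 3 * b ^ 2)) by (apply Rmult_le_pos; nra).
  assert (0 <= x ^ 2 * (3 * a)) by (apply Rmult_le_pos; [apply pow2_ge_0|lra]).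
  assert (0 <= x ^ 3) by (apply pow_le; assumption).
  nra.
Qed.

Lemma Re_conj_scal (k s : C) :
  Re (k * s ^ 2 * Cconj k)%C = Cmod k ^ 2 * Re (s ^ 2)%C.
Proof. rewrite Cmod2_alt. destruct k, s; simpl; ring. Qed.

Lemma cone_neq0 (T : C) : - Re T < 2 * Im T < Re T -> 0 < Cmod T.
Proof.
  intros h. eapply Rlt_le_trans; [|apply re_le_Cmod].
  eapply Rlt_le_trans; [|apply Rle_abs]. lra.
Qed.

(** If [G] were real and nonpositive, [k s ^ 2] would be [T] plus a nonnegative real, hence in the
    region, and its angle to [k] would put [s] in the sector of [kn_gap_root]. That makes
    [Re (G * secant)] positive, although the secant has positive real part and [G <= 0]. *)
Lemma kn_slit (z0 k s w T : C) :
  z0 <> 0 -> is_root z0 (- kn_coef z0) k -> is_root (z0 * s) w T ->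
  Re w + kn_weight (z0 * s) < 0 ->
  ~ (Im (T - k * s ^ 2)%C = 0 /\ Re (T - k * s ^ 2)%C <= 0).
Proof.
  intros hz hk hT hw [h1 h2].
  set (G := (T - k * s ^ 2)%C) in *. set (x := - Re G).
  assert (hK : (k * s ^ 2)%C = (T + x)%C).
  { replace (k * s ^ 2)%C with (T - G)%C by (unfold G; ring).
    unfold x. replace G with (RtoC (Re G)) at 1.
    - rewrite RtoC_opp. ring.
    - destruct G as [g1 g2]. simpl in h1. subst g2. reflexivity. }
  assert (hr := region_add _ _ x ltac:(unfold x; lra) (proj1 hT)). rewrite <- hK in hr.
  assert (hk0 := cone_neq0 k (proj1 (proj1 hk))).
  assert (ha := cone_angle _ _ (proj1 hr) (proj1 (proj1 hk))).
  rewrite Re_conj_scal, Cmod_mult, Cmod_pow in ha.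
  assert (hs : 14 / 25 * Cmod s ^ 2 <= Re (s ^ 2)%C).
  { assert (0 <= Cmod s ^ 2) by apply pow2_ge_0.
    apply Rle_trans with (3 / 5 * Cmod s ^ 2); [lra|].
    apply Rmult_le_reg_l with (Cmod k ^ 2); [apply pow_lt; assumption|lra]. }
  assert (hg := kn_gap_root z0 k s w T hz hk hT hw hs). fold G in hg.
  assert (hsec := secant_lower _ _ _ (proj1 hT) hr).
  assert (hT3 := proj2 (proj1 hT)).
  assert (h0 : 0 <= Cmod z0 ^ 8 * (Re (s ^ 2)%C ^ 2 * Im (s ^ 2)%C ^ 2 / 5)).
  { apply Rmult_le_pos; [apply pow_le, Cmod_ge_0|].
    assert (0 <= Re (s ^ 2)%C ^ 2) by apply pow2_ge_0.
    assert (0 <= Im (s ^ 2)%C ^ 2) by apply pow2_ge_0.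
    apply Rmult_le_pos; [apply Rmult_le_pos; assumption|lra]. }
  replace (Re (G * secant ((z0 * s) ^ 6) T (k * s ^ 2))%C)
    with (Re G * Re (secant ((z0 * s) ^ 6) T (k * s ^ 2))) in hg.
  - nra.
  - change (Re G * Re (secant ((z0 * s) ^ 6) T (k * s ^ 2))
      = Re G * Re (secant ((z0 * s) ^ 6) T (k * s ^ 2))
        - Im G * Im (secant ((z0 * s) ^ 6) T (k * s ^ 2))).
    rewrite h1. ring.
Qed.

(** The hypotheses reflect [|T| <= 2 Re T], [|k s ^ 2| <= |T| + |G|] with [G] small, and
    [root_growth]; [193 = 8 + 12 + 18 + 27 + 128]. *)
Lemma secant_bound (u a b : C) (x : R) :
  0 <= x -> Cmod a <= 2 * x -> Cmod b <= 3 * x -> Cmod u <= 64 * x ^ 3 ->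
  Cmod (secant u a b) <= 193 * x ^ 3.
Proof.
  intros hx ha hb hu. unfold secant.
  assert (ha0 := Cmod_ge_0 a). assert (hb0 := Cmod_ge_0 b).
  repeat (eapply Rle_trans; [apply Cmod_triangle|]; rewrite ?Rplus_assoc).
  eapply Rle_trans.
  { repeat apply Rplus_le_compat_r. apply Cmod_triangle. }
  eapply Rle_trans.
  { repeat apply Rplus_le_compat_r. apply Cmod_triangle. }
  eapply Rle_trans.
  { repeat apply Rplus_le_compat_r. apply Cmod_triangle. }
  rewrite !Cmod_mult, !Cmod_pow, Cmod_R, Rabs_pos_eq by lra.
  assert (Cmod a ^ 3 <= (2 * x) ^ 3) by (apply pow_incr; lra).
  assert (Cmod b ^ 3 <= (3 * x) ^ 3) by (apply pow_incr; lra).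
  assert (Cmod a ^ 2 * Cmod b <= (2 * x) ^ 2 * (3 * x)).
  { apply Rmult_le_compat; [apply pow_le; lra|lra|apply pow_incr; lra|lra]. }
  assert (Cmod a * Cmod b ^ 2 <= (2 * x) * (3 * x) ^ 2).
  { apply Rmult_le_compat; [lra|apply pow_le; lra|lra|apply pow_incr; lra]. }
  lra.
Qed.

(** The gap of [kn_gap_root] is quadratic in [Im s] and at most [|G|] times a secant. Where [G] is
    comparable to [T], growth alone suffices; elsewhere [T] and [k s ^ 2] have comparable size, so a
    factor [|s| ^ 6] appears on both sides and cancels, leaving a uniform constant. *)
Lemma imag_bound (z0 k : C) :
  z0 <> 0 -> is_root z0 (- kn_coef z0) k ->
  exists C1, 0 < C1 /\ forall s w T, is_root (z0 * s) w T ->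
    Re w + kn_weight (z0 * s) < 0 -> Im s ^ 2 <= C1 * Cmod (T - k * s ^ 2).
Proof.
  intros hz hk.
  assert (hz0 : 0 < Cmod z0) by now apply Cmod_gt_0.
  assert (hkk := cone_neq0 k (proj1 (proj1 hk))).
  set (t0 := Cmod z0 ^ 2). assert (ht0 : 0 < t0) by (apply pow_lt; assumption).
  set (C1 := 160 / t0). set (C2 := 193 * 8 * Cmod k ^ 3 * 10 / t0 ^ 4).
  assert (hk3 : 0 < Cmod k ^ 3) by (apply pow_lt; assumption).
  assert (ht4 : 0 < t0 ^ 4) by (apply pow_lt; assumption).
  assert (hC1 : 0 < C1) by (apply Rdiv_lt_0_compat; lra).
  assert (hC2 : 0 < C2) by (apply Rdiv_lt_0_compat; lra).
  exists (C1 + C2). split; [lra|].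
  intros s w T hT hw.
  set (G := (T - k * s ^ 2)%C). set (X := Re T).
  assert (hcone := proj1 (proj1 hT)).
  assert (hX : 0 < X) by (unfold X; lra).
  assert (hTX := Cmod_cone T hcone). fold X in hTX.
  assert (hXT : X <= Cmod T) by (eapply Rle_trans; [apply Rle_abs|apply re_le_Cmod]).
  assert (hG := Cmod_ge_0 G).
  assert (hb : Im s ^ 2 <= Cmod s ^ 2) by (rewrite Cmod2_alt; generalize (pow2_ge_0 (Re s)); lra).
  assert (hgrow : Cmod (z0 * s) ^ 2 <= 4 * X).
  { apply (root_growth (z0 * s) w T); [|assumption]. unfold kn_model.
    assert (0 <= Cmod (z0 * s) ^ 8) by (apply pow_le, Cmod_ge_0). lra. }
  assert (hgrow' := hgrow). rewrite Cmod_mult, Rpow_mult_distr in hgrow'. fold t0 in hgrow'.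
  (* The margin [3 / 5 - 14 / 25 = 1 / 25] keeps [s] in the sector as long as [39 |G| <= |T|], hence
     the threshold 40. *)
  destruct (Rle_dec X (40 * Cmod G)) as [hbig|hsmall].
  - apply Rle_trans with (C1 * Cmod G); [|nra].
    apply Rmult_le_reg_l with t0; [assumption|].
    replace (t0 * (C1 * Cmod G)) with (160 * Cmod G) by (unfold C1; field; lra).
    apply Rle_trans with (t0 * Cmod s ^ 2); [apply Rmult_le_compat_l; lra|lra].
  - apply Rle_trans with (C2 * Cmod G); [|nra].
    set (r := Cmod s ^ 2) in *. assert (hr : 0 <= r) by apply pow2_ge_0.
    assert (hK : Cmod (k * s ^ 2) = Cmod k * r) by (rewrite Cmod_mult, Cmod_pow; reflexivity).
    assert (hK1 : Cmod k * r <= Cmod T + Cmod G).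
    { rewrite <- hK. replace (k * s ^ 2)%C with (T + - G)%C by (unfold G; ring).
      eapply Rle_trans; [apply Cmod_triangle|]. rewrite Cmod_opp. lra. }
    assert (hK2 : Cmod T <= Cmod k * r + Cmod G).
    { rewrite <- hK. replace T with (k * s ^ 2 + G)%C at 1 by (unfold G; ring).
      apply Cmod_triangle. }
    assert (hs : 14 / 25 * r <= Re (s ^ 2)%C).
    { assert (ha := cone_angle _ _ hcone (proj1 (proj1 hk))).
      assert (hGk : Re (G * Cconj k)%C <= Cmod G * Cmod k).
      { eapply Rle_trans; [apply Rle_abs|]. eapply Rle_trans; [apply re_le_Cmod|].
        rewrite Cmod_mult, Cmod_conj. lra. }
      replace (Re (T * Cconj k)%C) with (Re (G * Cconj k)%C + Re (k * s ^ 2 * Cconj k)%C) in ha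
        by (change (Re (G * Cconj k + k * s ^ 2 * Cconj k)%C = Re (T * Cconj k)%C);
            f_equal; unfold G; ring).
      rewrite Re_conj_scal in ha.
      apply Rmult_le_reg_l with (Cmod k ^ 2); [apply pow_lt; assumption|].
      assert (Cmod k * (Cmod k * r) <= Cmod k * (Cmod T + Cmod G))
        by (apply Rmult_le_compat_l; lra).
      assert (0 <= Cmod k * (1 / 25 * Cmod T - 39 / 25 * Cmod G))
        by (apply Rmult_le_pos; lra).
      lra. }
    assert (hg := kn_gap_root z0 k s w T hz hk hT hw hs). fold G in hg.
    assert (hsec : Cmod (secant ((z0 * s) ^ 6) T (k * s ^ 2)) <= 193 * X ^ 3).
    { apply secant_bound; try lra.
      rewrite Cmod_pow. replace (Cmod (z0 * s) ^ 6) with ((Cmod (z0 * s) ^ 2) ^ 3) by ring.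
      apply Rle_trans with ((4 * X) ^ 3); [apply pow_incr; split; [apply pow2_ge_0|assumption]|].
      right; ring. }
    assert (hup : Cmod z0 ^ 8 * (Re (s ^ 2)%C ^ 2 * Im (s ^ 2)%C ^ 2 / 5)
                  <= Cmod G * (193 * X ^ 3)).
    { left. eapply Rlt_le_trans; [exact hg|].
      eapply Rle_trans; [apply Rle_abs|]. eapply Rle_trans; [apply re_le_Cmod|].
      rewrite Cmod_mult. apply Rmult_le_compat_l; assumption. }
    replace (Cmod z0 ^ 8) with (t0 ^ 4) in hup by (unfold t0; ring).
    (* [Im (s ^ 2) = 2 Re s Im s], and in the sector [Re (s ^ 2)] and [(Re s) ^ 2] are at least
       [14 / 25 * r]; [4 (14 / 25) ^ 3 > 1 / 2]. *)
    assert (hlow : r ^ 3 * Im s ^ 2 / 2 <= Re (s ^ 2)%C ^ 2 * Im (s ^ 2)%C ^ 2).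
    { clear - hs hr. unfold r in *. rewrite Cmod2_alt in *. destruct s as [a b].
      replace (Re ((a, b) ^ 2)%C) with (a ^ 2 - b ^ 2) in * by (simpl; ring).
      replace (Im ((a, b) ^ 2)%C) with (2 * a * b) by (simpl; ring).
      simpl (Re (a, b)) in *. simpl (Im (a, b)) in *.
      set (p := a ^ 2 - b ^ 2) in *. set (q := a ^ 2 + b ^ 2) in *.
      assert (hb : 0 <= b ^ 2) by apply pow2_ge_0.
      assert (ha : p <= a ^ 2) by (unfold p; lra).
      assert (hp : 0 <= p) by lra.
      assert (h1 : (14 / 25 * q) ^ 3 <= p ^ 3) by (apply pow_incr; lra).
      assert (h2 : p ^ 3 * b ^ 2 <= p ^ 2 * (a ^ 2 * b ^ 2)).
      { replace (p ^ 3 * b ^ 2) with (p ^ 2 * b ^ 2 * p) by ring.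
        replace (p ^ 2 * (a ^ 2 * b ^ 2)) with (p ^ 2 * b ^ 2 * a ^ 2) by ring.
        apply Rmult_le_compat_l; [apply Rmult_le_pos; [apply pow2_ge_0|assumption]|assumption]. }
      assert (h3 : (14 / 25 * q) ^ 3 * b ^ 2 <= p ^ 3 * b ^ 2)
        by (apply Rmult_le_compat_r; assumption).
      assert (h4 : 0 <= q ^ 3 * b ^ 2) by (apply Rmult_le_pos; [apply pow_le|]; assumption).
      lra. }
    assert (hrX : X ^ 3 <= 8 * Cmod k ^ 3 * r ^ 3).
    { apply Rle_trans with ((2 * (Cmod k * r)) ^ 3); [apply pow_incr; lra|right; ring]. }
    assert (hX3 : 0 < X ^ 3) by (apply pow_lt; assumption).
    apply Rmult_le_reg_l with (t0 ^ 4 / 10 * X ^ 3).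
    { apply Rmult_lt_0_compat; lra. }
    replace (t0 ^ 4 / 10 * X ^ 3 * (C2 * Cmod G))
      with (8 * Cmod k ^ 3 * (Cmod G * (193 * X ^ 3))) by (unfold C2; field; lra).
    apply Rle_trans with
      (8 * Cmod k ^ 3 * (t0 ^ 4 * (Re (s ^ 2)%C ^ 2 * Im (s ^ 2)%C ^ 2 / 5)));
      [|apply Rmult_le_compat_l; lra].
    apply Rle_trans with (8 * Cmod k ^ 3 * (t0 ^ 4 * ((r ^ 3 * Im s ^ 2 / 2) / 5))).
    + replace (8 * Cmod k ^ 3 * (t0 ^ 4 * (r ^ 3 * Im s ^ 2 / 2 / 5)))
        with (t0 ^ 4 / 10 * (8 * Cmod k ^ 3 * r ^ 3) * Im s ^ 2) by field.
      apply Rmult_le_compat_r; [apply pow2_ge_0|]. apply Rmult_le_compat_l; lra.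
    + apply Rmult_le_compat_l; [lra|]. apply Rmult_le_compat_l; lra.
Qed.

Lemma Re_div_conj (v h : C) : h <> 0 -> Re (v * Cconj h)%C = Cmod h ^ 2 * Re (v / h)%C.
Proof.
  intros hh. rewrite Cmod2_alt. replace v with (h * (v / h))%C at 1 by (field; assumption).
  set (q := (v / h)%C). destruct h, q; simpl; ring.
Qed.

Lemma Re_div_cone (T k : C) :
  - Re T < 2 * Im T < Re T -> - Re k < 2 * Im k < Re k ->
  3 / 5 * Cmod (T / k)%C <= Re (T / k)%C.
Proof.
  intros hT hk. assert (hk0 := cone_neq0 k hk).
  assert (hk1 : k <> 0) by now apply Cmod_gt_0.
  assert (h := cone_angle T k hT hk).
  rewrite (Re_div_conj _ _ hk1) in h. rewrite Cmod_div by assumption.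
  apply Rmult_le_reg_l with (Cmod k ^ 2); [apply pow_lt; assumption|].
  replace (Cmod k ^ 2 * (3 / 5 * (Cmod T / Cmod k))) with (3 / 5 * (Cmod T * Cmod k))
    by (field; lra).
  assumption.
Qed.

Lemma one_le_Cmod_one_plus_div (T k : C) :
  - Re T < 2 * Im T < Re T -> - Re k < 2 * Im k < Re k -> 1 <= Cmod (1 + T / k).
Proof.
  intros hT hk. assert (hq := Re_div_cone T k hT hk). assert (hq0 := Cmod_ge_0 (T / k)).
  eapply Rle_trans; [|apply re_le_Cmod]. eapply Rle_trans; [|apply Rle_abs].
  change (1 <= 1 + Re (T / k)%C). lra.
Qed.

(** For [d = 0] and real [s] the quotient is [(s - 1) ^ 2 / (1 + s ^ 2)]: nonnegative, bounded, and
    zero at 1 but not at -1. This is why [1 + T / k], which is [1 + s ^ 2 + G / k], serves as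
    denominator. The [5 / 2] comes from [2 x ^ 2 - 2 x - 2 >= - 5 / 2]. *)
Lemma Re_square_quotient (s d h : C) (h1 : h = (1 + s ^ 2 + d)%C) : h <> 0 ->
  ((Re s - 1) ^ 2 * (1 + Re s ^ 2) - 5 / 2 * Im s ^ 2 - 2 * (1 + Cmod s ^ 2) * Cmod d)
    / Cmod h ^ 2
  <= Re ((s - 1) ^ 2 / h)%C.
Proof.
  intros hh. assert (hm : 0 < Cmod h) by now apply Cmod_gt_0.
  assert (hm2 : 0 < Cmod h ^ 2) by (apply pow_lt; assumption).
  apply Rmult_le_reg_l with (Cmod h ^ 2); [assumption|].
  rewrite <- Re_div_conj by assumption. unfold Rdiv at 1.
  rewrite (Rmult_comm _ (/ Cmod h ^ 2)), <- Rmult_assoc, Rinv_r, Rmult_1_l by lra.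
  assert (e : Re ((s - 1) ^ 2 * Cconj h)%C
    = (Re s - 1) ^ 2 * (1 + Re s ^ 2)
      + Im s ^ 2 * (2 * Re s ^ 2 - 2 * Re s - 2 + Im s ^ 2)
      + Re ((s - 1) ^ 2 * Cconj d)%C)
    by (rewrite h1; destruct s, d; simpl; ring).
  rewrite e.
  assert (hd : - (2 * (1 + Cmod s ^ 2) * Cmod d) <= Re ((s - 1) ^ 2 * Cconj d)%C).
  { assert (k1 := re_le_Cmod ((s - 1) ^ 2 * Cconj d)).
    rewrite Cmod_mult, Cmod_conj, Cmod_pow in k1. apply Rabs_le_between in k1.
    assert (k2 : Cmod (s - 1) ^ 2 <= 2 * (1 + Cmod s ^ 2)).
    { rewrite !Cmod2_alt. destruct s as [a b]. simpl.
      generalize (pow2_ge_0 (a + 1)) (pow2_ge_0 b). lra. }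
    assert (k3 := Rmult_le_compat_r (Cmod d) _ _ (Cmod_ge_0 d) k2). lra. }
  assert (0 <= Im s ^ 2 * (2 * (Re s - 1 / 2) ^ 2 + Im s ^ 2)).
  { apply Rmult_le_pos; [apply pow2_ge_0|].
    generalize (pow2_ge_0 (Re s - 1 / 2)) (pow2_ge_0 (Im s)). lra. }
  lra.
Qed.

Lemma Re_root4 (b : C) : 0 < Re b -> 0 < Re (b ^ 2)%C -> Cmod b <= 2 * Re b.
Proof.
  intros h1 h2. eapply Rle_trans; [apply Cmod_le_abs|].
  rewrite (Rabs_pos_eq (Re b)) by lra.
  replace (Re (b ^ 2)%C) with (Re b ^ 2 - Im b ^ 2) in h2 by (destruct b; simpl; ring).
  enough (Rabs (Im b) <= Re b) by lra. apply Rabs_le. nra.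
Qed.

(** The error terms of [Re_square_quotient] are at most a multiple of [|G| |h|]. Dividing by
    [|h| ^ 2] leaves [|G| / |h|], which stays below a multiple of [|b|] even at infinity in this
    unbounded domain. *)
Lemma support_real_part (z0 k : C) :
  z0 <> 0 -> is_root z0 (- kn_coef z0) k ->
  exists M : R, 0 < M /\ forall s w T b, is_root (z0 * s) w T ->
    Re w + kn_weight (z0 * s) < 0 ->
    (b ^ 4)%C = (T - k * s ^ 2)%C -> 0 < Re b -> 0 < Re (b ^ 2)%C ->
    Cmod b + (Re s - 1) ^ 2 * (1 + Re s ^ 2) / Cmod (1 + T / k) ^ 2
    <= Re (M * b + (s - 1) ^ 2 / (1 + T / k))%C.
Proof.
  intros hz hk.
  destruct (imag_bound z0 k hz hk) as [C1 [hC1 hbound]].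
  assert (hz0 : 0 < Cmod z0) by now apply Cmod_gt_0.
  assert (hkk := cone_neq0 k (proj1 (proj1 hk))).
  set (t0 := Cmod z0 ^ 2). assert (ht0 : 0 < t0) by (apply pow_lt; assumption).
  set (m := Cmod k) in *.
  (* [|s|^2 <= A |h|] and [|G| <= (2 m + m A) |h|], with [h = 1 + T / k] and [G = b ^ 4]. *)
  set (A := 8 * m / t0). assert (hA : 0 < A) by (apply Rdiv_lt_0_compat; lra).
  set (C2 := 5 / 2 * C1 + 2 * (1 + A) / m).
  assert (hC2 : 0 < C2).
  { assert (0 < 2 * (1 + A) / m) by (apply Rdiv_lt_0_compat; lra). unfold C2; lra. }
  set (C4 := 1 + 2 * m + m * A).
  assert (hC4 : 1 < C4) by (unfold C4; assert (0 < m * A) by nra; lra).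
  (* As [|b| <= 2 Re b], this multiple of [Re b] absorbs the error [C2 * C4 * |b|] and leaves
     [|b|]. *)
  exists (2 * (1 + C2 * C4)). split; [nra|].
  intros s w T b hT hw hb4 hb1 hb2.
  set (h := (1 + T / k)%C). set (G := (T - k * s ^ 2)%C) in *.
  assert (hk1 : k <> 0) by now apply Cmod_gt_0.
  assert (hq := Re_div_cone T k (proj1 (proj1 hT)) (proj1 (proj1 hk))).
  assert (hqm := Cmod_div T k hk1). fold m in hqm.
  assert (hq0 := Cmod_ge_0 (T / k)).
  assert (hRe : Re h = 1 + Re (T / k)%C) by reflexivity.
  assert (hh : 1 + 3 / 5 * Cmod (T / k) <= Cmod h).
  { eapply Rle_trans; [|apply re_le_Cmod]. eapply Rle_trans; [|apply Rle_abs]. lra. }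
  assert (hhne : h <> 0) by (apply Cmod_gt_0; lra).
  assert (hTm : Cmod T = m * Cmod (T / k)) by (rewrite hqm; field; lra).
  assert (hs : Cmod s ^ 2 <= A * Cmod h).
  { assert (hgrow : Cmod (z0 * s) ^ 2 <= 4 * Re T).
    { apply (root_growth (z0 * s) w T); [|assumption]. unfold kn_model.
      assert (0 <= Cmod (z0 * s) ^ 8) by (apply pow_le, Cmod_ge_0). lra. }
    rewrite Cmod_mult, Rpow_mult_distr in hgrow. fold t0 in hgrow.
    assert (Re T <= Cmod T) by (eapply Rle_trans; [apply Rle_abs|apply re_le_Cmod]).
    apply Rmult_le_reg_l with t0; [assumption|].
    replace (t0 * (A * Cmod h)) with (8 * (m * Cmod h)) by (unfold A; field; lra).
    assert (m * Cmod (T / k) <= m * (5 / 3 * Cmod h)) by (apply Rmult_le_compat_l; lra).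
    assert (0 <= m * Cmod h) by (apply Rmult_le_pos; lra).
    lra. }
  assert (hG : Cmod G = Cmod b ^ 4) by (rewrite <- hb4; apply Cmod_pow).
  assert (hbeta := Cmod_ge_0 b). set (beta := Cmod b) in *.
  assert (hGh : Cmod G <= C4 * Cmod h).
  { replace G with (T + - (k * s ^ 2))%C by (unfold G; ring).
    eapply Rle_trans; [apply Cmod_triangle|]. rewrite Cmod_opp, Cmod_mult, Cmod_pow. fold m.
    assert (m * Cmod (T / k) <= m * (5 / 3 * Cmod h)) by (apply Rmult_le_compat_l; lra).
    assert (m * Cmod s ^ 2 <= m * (A * Cmod h)) by (apply Rmult_le_compat_l; lra).
    assert (0 <= m * Cmod h) by (apply Rmult_le_pos; lra).
    unfold C4. lra. }
  (* [|G| / |h| <= C4 beta], separating [beta <= 1] from [beta > 1] *)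
  assert (hGb : Cmod G <= C4 * beta * Cmod h).
  { destruct (Rle_dec beta 1) as [h1|h1].
    - rewrite hG. apply Rle_trans with (beta * 1).
      + assert (beta ^ 3 <= 1 ^ 3) by (apply pow_incr; lra). nra.
      + assert (0 <= beta * (C4 * Cmod h - 1)) by (apply Rmult_le_pos; nra). lra.
    - assert (0 <= (beta - 1) * (C4 * Cmod h)) by (apply Rmult_le_pos; nra). lra. }
  assert (hsq := Re_square_quotient s (G / k) h
    ltac:(unfold h, G; field; assumption) hhne).
  rewrite Cmod_div in hsq by assumption. fold m in hsq.
  assert (him := hbound s w T hT hw). fold G in him.
  set (N := (Re s - 1) ^ 2 * (1 + Re s ^ 2)) in *.
  assert (hnum : N - C2 * Cmod G * Cmod h
    <= N - 5 / 2 * Im s ^ 2 - 2 * (1 + Cmod s ^ 2) * (Cmod G / m)).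
  { assert (0 <= Cmod G) by apply Cmod_ge_0.
    assert (k1 : Cmod G <= Cmod G * Cmod h) by nra.
    assert (k2 : (1 + Cmod s ^ 2) * (Cmod G / m) <= (1 + A) * Cmod h * (Cmod G / m)).
    { apply Rmult_le_compat_r; [|lra]. apply Rdiv_le_0_compat; lra. }
    unfold C2.
    replace ((5 / 2 * C1 + 2 * (1 + A) / m) * Cmod G * Cmod h)
      with (5 / 2 * C1 * (Cmod G * Cmod h) + 2 * ((1 + A) * Cmod h * (Cmod G / m)))
      by (field; lra).
    assert (C1 * Cmod G <= C1 * (Cmod G * Cmod h)) by (apply Rmult_le_compat_l; lra).
    lra. }
  assert (hfin : N / Cmod h ^ 2 - C2 * C4 * beta <= Re ((s - 1) ^ 2 / h)%C).
  { eapply Rle_trans; [|exact hsq].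
    assert (hm2 : 0 < Cmod h ^ 2) by (apply pow_lt; lra).
    apply Rmult_le_reg_r with (Cmod h ^ 2); [assumption|].
    replace ((N / Cmod h ^ 2 - C2 * C4 * beta) * Cmod h ^ 2)
      with (N - C2 * (C4 * beta * Cmod h) * Cmod h) by (field; lra).
    match goal with |- _ <= ?E / ?d * ?d => replace (E / d * d) with E by (field; lra) end.
    eapply Rle_trans; [|exact hnum].
    assert (C2 * Cmod G * Cmod h <= C2 * (C4 * beta * Cmod h) * Cmod h).
    { apply Rmult_le_compat_r; [lra|]. apply Rmult_le_compat_l; lra. }
    lra. }
  assert (hRb := Re_root4 b hb1 hb2). fold beta in hRb.
  replace (Re ((2 * (1 + C2 * C4))%R * b + (s - 1) ^ 2 / h)%C)
    with (2 * (1 + C2 * C4) * Re b + Re ((s - 1) ^ 2 / h)%C)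
    by (unfold Re; simpl; ring).
  assert (0 <= C2 * C4) by nra.
  assert ((1 + C2 * C4) * beta <= (1 + C2 * C4) * (2 * Re b)) by (apply Rmult_le_compat_l; lra).
  lra.
Qed.

(** A small value makes [b] small, hence [G], hence [Im s]. For [Re s], the bound
    [|h| <= D (1 + (Re s) ^ 2)] yields [(Re s - 1) ^ 2 <= c D ^ 2 (1 + (Re s) ^ 2)], and
    [c D ^ 2 <= 1 / 4] excludes both large [Re s] and the antipode [s = -1]. *)
Lemma support_small (z0 k : C) :
  z0 <> 0 -> is_root z0 (- kn_coef z0) k ->
  exists M : R, 0 < M /\
    (forall s w T b, is_root (z0 * s) w T -> Re w + kn_weight (z0 * s) < 0 ->
      (b ^ 4)%C = (T - k * s ^ 2)%C -> 0 < Re b -> 0 < Re (b ^ 2)%C ->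
      0 <= Re (M * b + (s - 1) ^ 2 / (1 + T / k))%C) /\
    forall d, 0 < d -> exists c, 0 < c /\
      forall s w T b, is_root (z0 * s) w T -> Re w + kn_weight (z0 * s) < 0 ->
      (b ^ 4)%C = (T - k * s ^ 2)%C -> 0 < Re b -> 0 < Re (b ^ 2)%C ->
      Re (M * b + (s - 1) ^ 2 / (1 + T / k))%C < c ->
      Cmod (s - 1) < d /\ Cmod (T - k * s ^ 2) < d.
Proof.
  intros hz hk.
  destruct (imag_bound z0 k hz hk) as [C1 [hC1 hbound]].
  destruct (support_real_part z0 k hz hk) as [M [hM hsupp]].
  assert (hm := cone_neq0 k (proj1 (proj1 hk))).
  assert (hk1 : k <> 0) by now apply Cmod_gt_0.
  assert (hh : forall z w T, is_root z w T -> 1 <= Cmod (1 + T / k)).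
  { intros z w T hT. apply one_le_Cmod_one_plus_div; [apply hT|apply hk]. }
  assert (hN : forall s T : C, 1 <= Cmod (1 + T / k) ->
    0 <= (Re s - 1) ^ 2 * (1 + Re s ^ 2) / Cmod (1 + T / k) ^ 2).
  { intros s T h1. apply Rdiv_le_0_compat; [|apply pow_lt; lra].
    apply Rmult_le_pos; [apply pow2_ge_0|generalize (pow2_ge_0 (Re s)); lra]. }
  exists M. split; [assumption|split].
  - intros s w T b hT hw h1 h2 h3.
    eapply Rle_trans; [|exact (hsupp s w T b hT hw h1 h2 h3)].
    assert (h4 := Cmod_ge_0 b). assert (h5 := hN s T (hh _ _ _ hT)). lra.
  - intros d hd.
    assert (him : 0 < / Cmod k) by now apply Rinv_0_lt_compat.
    (* [E] is made for the final estimate [|s - 1| ^ 2 <= c (6 D ^ 2 + C1)]. *)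
    set (D := 1 + C1 + / Cmod k). set (E := 6 * D ^ 2 + C1 + 1).
    assert (hD : 1 < D) by (unfold D; lra).
    assert (hD2 : 1 < D ^ 2) by nra.
    assert (hE : 0 < E) by (unfold E; lra).
    assert (hd2 : 0 < d ^ 2) by (apply pow_lt; assumption).
    set (e := Rmin 1 (Rmin d (d ^ 2))).
    assert (he : 0 < e) by (apply Rmin_case; [lra|apply Rmin_case; lra]).
    assert (he1 : e <= 1) by apply Rmin_l.
    assert (he2 : e <= d) by (eapply Rle_trans; [apply Rmin_r|apply Rmin_l]).
    assert (he3 : e <= d ^ 2) by (eapply Rle_trans; [apply Rmin_r|apply Rmin_r]).
    clearbody e. set (c := e / (2 * E)).
    assert (hc : 0 < c) by (apply Rdiv_lt_0_compat; lra).
    assert (hcE : c * (2 * E) = e) by (unfold c; field; lra).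
    assert (hce : c < e) by (unfold E in *; nra).
    clearbody c.
    exists c. split; [assumption|].
    intros s w T b hT hw h1 h2 h3 hlt.
    assert (hs := hsupp s w T b hT hw h1 h2 h3).
    assert (hb0 := Cmod_ge_0 b). assert (hh1 := hh _ _ _ hT). assert (hN1 := hN s T hh1).
    assert (hbc : Cmod b < c) by lra.
    assert (hG : Cmod (T - k * s ^ 2) < c).
    { rewrite <- h1, Cmod_pow. apply Rle_lt_trans with (Cmod b * 1 ^ 3); [|lra].
      change (Cmod b * Cmod b ^ 3 <= Cmod b * 1 ^ 3).
      apply Rmult_le_compat_l; [assumption|]. apply pow_incr. lra. }
    split; [|lra].
    assert (hG0 := Cmod_ge_0 (T - k * s ^ 2)).
    assert (hbd := hbound s w T hT hw).
    assert (hIm : Im s ^ 2 <= C1 * c).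
    { eapply Rle_trans; [exact hbd|]. apply Rmult_le_compat_l; lra. }
    assert (hIm' : C1 * c <= C1) by nra.
    assert (hRe0 := pow2_ge_0 (Re s)).
    assert (hhD : Cmod (1 + T / k) <= D * (1 + Re s ^ 2)).
    { replace (1 + T / k)%C with (1 + s ^ 2 + (T - k * s ^ 2) / k)%C by (field; assumption).
      eapply Rle_trans; [apply Cmod_triangle|].
      eapply Rle_trans; [apply Rplus_le_compat_r, Cmod_triangle|].
      rewrite Cmod_1, Cmod_pow, Cmod_div, Cmod2_alt by assumption.
      assert (Cmod (T - k * s ^ 2) / Cmod k <= 1 * / Cmod k)
        by (apply Rmult_le_compat_r; lra).
      assert (0 <= (C1 + / Cmod k) * Re s ^ 2) by (apply Rmult_le_pos; lra).
      unfold D. lra. }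
    assert (hlt2 : (Re s - 1) ^ 2 * (1 + Re s ^ 2) / Cmod (1 + T / k) ^ 2 <= c) by lra.
    set (h := Cmod (1 + T / k)) in *.
    assert (hh2 : h ^ 2 <= (D * (1 + Re s ^ 2)) ^ 2) by (apply pow_incr; lra).
    assert (hprod : (Re s - 1) ^ 2 * (1 + Re s ^ 2) <= c * (D * (1 + Re s ^ 2)) ^ 2).
    { apply Rle_trans with (c * h ^ 2); [|apply Rmult_le_compat_l; lra].
      replace ((Re s - 1) ^ 2 * (1 + Re s ^ 2))
        with ((Re s - 1) ^ 2 * (1 + Re s ^ 2) / h ^ 2 * h ^ 2) by (field; lra).
      apply Rmult_le_compat_r; [apply pow2_ge_0|assumption]. }
    assert (hred : (Re s - 1) ^ 2 <= c * D ^ 2 * (1 + Re s ^ 2)).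
    { apply Rmult_le_reg_r with (1 + Re s ^ 2); [lra|].
      eapply Rle_trans; [exact hprod|]. right; ring. }
    assert (hcD : c * D ^ 2 <= 1 / 4).
    { unfold E in hcE. assert (0 <= c * (C1 + 1)) by (apply Rmult_le_pos; lra). lra. }
    assert (hcD0 : 0 <= c * D ^ 2) by (apply Rmult_le_pos; lra).
    assert (hsq : (Re s - 1) ^ 2 <= 6 * (c * D ^ 2)).
    { set (a := Re s) in *. set (q := c * D ^ 2) in *. clearbody a q.
      clear - hred hcD hcD0.
      assert (h := pow2_ge_0 (a - 2)). assert (h' := pow2_ge_0 (a - 1)).
      assert (0 <= (1 / 4 - q) * (a - 1) ^ 2) by (apply Rmult_le_pos; lra).
      assert (q * (1 + a ^ 2) <= q * (3 + 2 * (a - 1) ^ 2)) by (apply Rmult_le_compat_l; lra).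
      lra. }
    apply Rlt_le_trans with (sqrt (d ^ 2)); [|rewrite sqrt_pow2; lra].
    rewrite <- (sqrt_pow2 (Cmod (s - 1))) by apply Cmod_ge_0.
    apply sqrt_lt_1; [apply pow2_ge_0|lra|].
    rewrite Cmod2_alt.
    replace (Re (s - 1)%C) with (Re s - 1) by reflexivity.
    replace (Im (s - 1)%C) with (Im s) by (unfold Im; simpl; ring).
    unfold E in hcE. lra.
Qed.

(** * Peak functions on the domain *)

Lemma diff_fst (x : C2) : diff_at (fun y : C2 => fst y) x.
Proof.
  apply ex_filterdiff_linear.
  exact (is_linear_fst (K := C_AbsRing) (U := C_NormedModule) (V := C_NormedModule)).
Qed.

Lemma diff_snd (x : C2) : diff_at (fun y : C2 => snd y) x.
Proof.
  apply ex_filterdiff_linear.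
  exact (is_linear_snd (K := C_AbsRing) (U := C_NormedModule) (V := C_NormedModule)).
Qed.

Lemma ccont_conj {U : UniformSpace} (f : U -> C) (x : U) :
  ccont f x -> ccont (fun y => Cconj (f y)) x.
Proof.
  intros hf eps heps. generalize (hf eps heps). apply filter_imp. intros y hy.
  replace (Cconj (f y) - Cconj (f x))%C with (Cconj (f y - f x)).
  - now rewrite Cmod_conj.
  - destruct (f y), (f x). unfold Cconj, Cminus, Cplus, Copp; simpl. f_equal; ring.
Qed.

Lemma ccont_fst (x : C2) : ccont (fun y : C2 => fst y) x.
Proof. apply ccont_of_diff, diff_fst. Qed.

Lemma ccont_snd (x : C2) : ccont (fun y : C2 => snd y) x.
Proof. apply ccont_of_diff, diff_snd. Qed.

Ltac ccont_tac :=
  repeat first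
    [ apply ccont_const | apply ccont_fst | apply ccont_snd | assumption
    | apply ccont_minus | apply ccont_plus | apply ccont_opp | apply ccont_mult
    | apply ccont_pow | apply ccont_conj ].

(** A polynomial in [z] and its conjugate with real part [kn_weight z]: the continuity lemmas
    concern complex-valued functions. *)
Definition kn_weight_C (z : C) : C :=
  ((z * Cconj z) ^ 4 + RtoC (15 / 7) * (z * Cconj z) * z ^ 6)%C.

Lemma Re_kn_weight_C (z : C) : Re (kn_weight_C z) = kn_weight z.
Proof.
  unfold kn_weight_C, kn_weight. rewrite <- Cmod2_conj, <- RtoC_pow.
  set (u := (z ^ 6)%C). destruct u as [a b].
  replace (Cmod z ^ 8) with ((Cmod z ^ 2) ^ 4) by ring.
  set (t := Cmod z ^ 2). unfold Re; simpl. ring.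
Qed.

Definition kn_defining (x : C2) : C :=
  (snd x + (fst x * snd x) * Cconj (fst x * snd x) + kn_weight_C (fst x))%C.

Lemma Re_kn_defining (x : C2) :
  Re (kn_defining x) = Re (snd x) + Cmod (fst x * snd x) ^ 2 + kn_weight (fst x).
Proof.
  unfold kn_defining. rewrite <- Cmod2_conj, <- Re_kn_weight_C. reflexivity.
Qed.

Lemma Omega_KN_defining (x : C2) : Omega_KN x <-> Re (kn_defining x) < 0.
Proof. rewrite Re_kn_defining. unfold Omega_KN, kn_weight. split; intros; lra. Qed.

Lemma ccont_kn_defining (x : C2) : ccont kn_defining x.
Proof. unfold kn_defining, kn_weight_C. ccont_tac. Qed.

Lemma ccont_Re_lt {U : UniformSpace} (f : U -> C) (x : U) (c : R) :
  ccont f x -> Re (f x) < c -> locally x (fun y => Re (f y) < c).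
Proof.
  intros hf hc.
  assert (h : - c < Re (- f x)%C) by (unfold Re in *; simpl; lra).
  generalize (ccont_Re_gt _ _ _ (ccont_opp f x hf) h).
  apply filter_imp. intros y hy. unfold Re in *; simpl in hy; lra.
Qed.

Lemma Omega_KN_open (x : C2) : Omega_KN x -> locally x Omega_KN.
Proof.
  intros hx. apply Omega_KN_defining in hx.
  generalize (ccont_Re_lt _ _ _ (ccont_kn_defining x) hx).
  apply filter_imp. intros y. apply Omega_KN_defining.
Qed.

Lemma boundary_defining (p : C2) : boundary Omega_KN p -> Re (kn_defining p) = 0.
Proof.
  intros [hcl hint].
  destruct (Rtotal_order (Re (kn_defining p)) 0) as [h|[h|h]]; [|assumption|].
  - exfalso. apply hint, Omega_KN_open. now apply Omega_KN_defining.
  - exfalso. destruct (hcl _ (ccont_Re_gt _ _ _ (ccont_kn_defining p) h)) as [q [h1 h2]].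
    apply Omega_KN_defining in h2. lra.
Qed.

(* [|z w|^2] exceeds the real part of a holomorphic function by [|z w - y|^2];
   absorbing the latter into [w] makes the domain look like [Re w + kn_weight z < 0]. *)
Definition shear (y : C) (nu : R) (x : C2) : C :=
  (snd x + 2 * Cconj y * (fst x * snd x) - RtoC (Cmod y ^ 2) - (0, nu))%C.

Lemma Re_shear (y : C) (nu : R) (x : C2) :
  Re (shear y nu x) + Cmod (fst x * snd x - y) ^ 2
  = Re (snd x) + Cmod (fst x * snd x) ^ 2.
Proof.
  unfold shear. rewrite !Cmod2_alt.
  set (v := (fst x * snd x)%C). set (w := snd x).
  change (Re (w + 2 * Cconj y * v - (Re y ^ 2 + Im y ^ 2)%R - (0, nu))%C
          + (Re (v - y)%C ^ 2 + Im (v - y)%C ^ 2) = Re w + (Re v ^ 2 + Im v ^ 2)).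
  clearbody v w. destruct v, w, y. simpl. ring.
Qed.

Lemma Omega_KN_shear (y : C) (nu : R) (x : C2) :
  Omega_KN x ->
  Re (shear y nu x) + Cmod (fst x * snd x - y) ^ 2 + kn_weight (fst x) < 0.
Proof.
  intros hx. apply Omega_KN_defining in hx. rewrite Re_kn_defining in hx.
  rewrite Re_shear. assumption.
Qed.

Lemma Omega_KN_model (y : C) (nu : R) (x : C2) :
  Omega_KN x -> Re (shear y nu x) + kn_weight (fst x) < 0.
Proof.
  intros hx. apply (Omega_KN_shear y nu) in hx.
  generalize (pow2_ge_0 (Cmod (fst x * snd x - y))). lra.
Qed.

Lemma model_of_lt (z w : C) : Re w + kn_weight z < 0 -> kn_model z w.
Proof.
  intros h. unfold kn_model.
  assert (0 <= Cmod z ^ 8) by (apply pow_le, Cmod_ge_0). lra.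
Qed.

Lemma diff_shear (y : C) (nu : R) (x : C2) : diff_at (shear y nu) x.
Proof.
  unfold shear.
  apply ex_filterdiff_Cplus; [|apply ex_filterdiff_Cconst].
  apply ex_filterdiff_Cplus; [|apply ex_filterdiff_Cconst].
  apply ex_filterdiff_Cplus; [apply diff_snd|].
  apply ex_filterdiff_Cscal, ex_filterdiff_Cmult; [apply diff_fst|apply diff_snd].
Qed.

Lemma norm_C2_le (x p : C2) :
  norm (minus x p) <= Cmod (fst x - fst p) + Cmod (snd x - snd p).
Proof.
  change (norm (minus x p))
    with (sqrt (Cmod (fst x - fst p) ^ 2 + Cmod (snd x - snd p) ^ 2)).
  assert (h1 := Cmod_ge_0 (fst x - fst p)). assert (h2 := Cmod_ge_0 (snd x - snd p)).
  rewrite <- (sqrt_pow2 (Cmod (fst x - fst p) + Cmod (snd x - snd p))) by lra.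
  apply sqrt_le_1_alt. nra.
Qed.

Lemma ball_C2 (p x : C2) (d : R) :
  Cmod (fst x - fst p) < d -> Cmod (snd x - snd p) < d -> ball p d x.
Proof.
  intros h1 h2.
  assert (k1 := Rle_lt_trans _ _ _ (re_le_Cmod _) h1).
  assert (k2 := Rle_lt_trans _ _ _ (im_le_Cmod _) h1).
  assert (k3 := Rle_lt_trans _ _ _ (re_le_Cmod _) h2).
  assert (k4 := Rle_lt_trans _ _ _ (im_le_Cmod _) h2).
  split; split; assumption.
Qed.

Lemma ccont_Cmod_lt {U : UniformSpace} (f : U -> C) (x : U) (eps : R) :
  ccont f x -> f x = 0 -> 0 < eps -> locally x (fun y => Cmod (f y) < eps).
Proof.
  intros hf h0 heps. generalize (hf eps heps). apply filter_imp. intros y.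
  rewrite h0. now replace (f y - 0)%C with (f y) by ring.
Qed.

Lemma peak_at_axis (p : C2) : fst p = RtoC 0 -> Re (kn_defining p) = 0 ->
  exists f : C2 -> C, peak_function Omega_KN p f.
Proof.
  intros hz hp.
  destruct root_function as [tau htau].
  set (nu := Im (snd p)). set (W := shear (RtoC 0) nu).
  assert (hroot : forall x, Omega_KN x -> is_root (fst x) (W x) (tau (fst x) (W x))).
  { intros x hx. apply htau, model_of_lt. now apply Omega_KN_model. }
  assert (hWw : forall x : C2, W x = (snd x - (0, nu))%C).
  { intros x. unfold W, shear. rewrite Cmod_0. destruct (fst x), (snd x).
    unfold Cconj, Cminus, Cplus, Copp, Cmult, RtoC; simpl. f_equal; ring. }
  assert (hw0 : snd p = (0, nu)).
  { rewrite Re_kn_defining in hp. unfold kn_weight in hp. rewrite hz in hp.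
    rewrite Cmult_0_l, Cmod_0 in hp. unfold nu.
    destruct (snd p) as [a b]. simpl in *. f_equal. lra. }
  assert (hWp : W p = 0) by (rewrite hWw, hw0; ring).
  assert (hcone : forall x, Omega_KN x -> Cmod (tau (fst x) (W x)) <= 2 * Re (tau (fst x) (W x)))
    by (intros x hx; apply Cmod_cone, (proj1 (proj1 (hroot x hx)))).
  apply (peak_of_real_part _ _ (fun x => tau (fst x) (W x)) Omega_KN_open).
  - intros x hx. apply (root_diff (fun x : C2 => fst x) W).
    + apply diff_fst.
    + apply diff_shear.
    + generalize (Omega_KN_open x hx). apply filter_imp. exact hroot.
  - intros x hx. assert (h := proj1 (proj1 (hroot x hx))). lra.
  - intros eps heps.
    assert (h1 : 0 < eps ^ 3) by (apply pow_lt; assumption).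
    assert (h2 : 0 < eps ^ 4) by (apply pow_lt; assumption).
    assert (c1 : ccont (fun x : C2 => fst x ^ 6)%C p) by ccont_tac.
    assert (c2 : ccont W p) by (unfold W; apply ccont_of_diff, diff_shear).
    assert (k1 := ccont_Cmod_lt _ _ (eps ^ 3 / 4) c1 ltac:(cbv beta; rewrite hz; ring) ltac:(lra)).
    assert (k2 := ccont_Cmod_lt _ _ (eps ^ 4 / 4) c2 hWp ltac:(lra)).
    generalize (filter_and _ _ k1 k2). unfold within. apply filter_imp.
    intros x [h3 h4] hx. apply Rnot_le_lt. intros hge.
    assert (hr := proj2 (hroot x hx)).
    set (T := tau (fst x) (W x)) in *.
    assert (h5 : Cmod T ^ 4 <= 2 * Cmod (fst x ^ 6) * Cmod T + Cmod (W x)).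
    { rewrite <- Cmod_pow.
      replace (T ^ 4)%C with (quartic (fst x ^ 6) (W x) T + - (2 * fst x ^ 6 * T) + - W x)%C
        by (unfold quartic; ring).
      rewrite hr, Cplus_0_l.
      eapply Rle_trans; [apply Cmod_triangle|]. rewrite !Cmod_opp, !Cmod_mult, Cmod_R.
      rewrite Rabs_pos_eq by lra. lra. }
    assert (h6 : eps ^ 3 <= Cmod T ^ 3) by (apply pow_incr; lra).
    assert (h7 : eps ^ 4 <= Cmod T ^ 4) by (apply pow_incr; lra).
    assert (h8 : eps ^ 3 * Cmod T <= Cmod T ^ 3 * Cmod T) by (apply Rmult_le_compat_r; lra).
    assert (2 * Cmod (fst x ^ 6) * Cmod T <= eps ^ 3 / 2 * Cmod T)
      by (apply Rmult_le_compat_r; lra).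
    lra.
  - intros r hr.
    (* [Re T < e ^ 2] implies [|z| <= 2 e] by growth and [|W| <= (16 + 256) e] by the equation, in
       total [274 e < r]. *)
    set (e := Rmin 1 (r / 300)).
    assert (he : 0 < e) by (apply Rmin_case; lra).
    assert (he1 : e <= 1) by apply Rmin_l. assert (he2 : e <= r / 300) by apply Rmin_r.
    clearbody e.
    exists (e ^ 2). split; [apply pow_lt; assumption|].
    intros x hx hb. apply Rnot_lt_le. intros hlt. apply hb.
    assert (hg := root_growth _ _ _ (model_of_lt _ _ (Omega_KN_model 0 nu x hx)) (hroot x hx)).
    assert (hT := hcone x hx). assert (hq := proj2 (hroot x hx)).
    set (T := tau (fst x) (W x)) in *.
    assert (hz2 : Cmod (fst x) <= 2 * e).
    { apply Rnot_lt_le. intros h. nra. }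
    assert (hT2 : Cmod T <= 2 * e) by nra.
    assert (hz0 := Cmod_ge_0 (fst x)). assert (hT0 := Cmod_ge_0 T).
    assert (hW : Cmod (W x) <= 272 * e).
    { replace (W x) with (- T ^ 4 + - (2 * fst x ^ 6 * T))%C.
      - eapply Rle_trans; [apply Cmod_triangle|].
        rewrite !Cmod_opp, !Cmod_mult, !Cmod_pow, Cmod_R, Rabs_pos_eq by lra.
        assert (q1 : Cmod T ^ 4 <= (2 * e) ^ 4) by (apply pow_incr; lra).
        assert (q2 : Cmod (fst x) ^ 6 <= (2 * e) ^ 6) by (apply pow_incr; lra).
        assert (q3 : e ^ 3 <= 1 ^ 3) by (apply pow_incr; lra).
        assert (q4 : e ^ 6 <= 1 ^ 6) by (apply pow_incr; lra).
        assert (q5 : e * e ^ 3 <= e * 1 ^ 3) by (apply Rmult_le_compat_l; lra).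
        assert (q6 : e * e ^ 6 <= e * 1 ^ 6) by (apply Rmult_le_compat_l; lra).
        assert (q7 : 2 * Cmod (fst x) ^ 6 * Cmod T <= 2 * (2 * e) ^ 6 * (2 * e)).
        { apply Rmult_le_compat; try lra.
          apply Rmult_le_pos; [lra|apply pow_le; lra]. }
        lra.
      - transitivity (W x - quartic (fst x ^ 6) (W x) T)%C; [unfold quartic; ring|].
        rewrite hq. ring. }
    unfold norm_ball. eapply Rle_lt_trans; [apply norm_C2_le|].
    rewrite hz, hw0, <- hWw.
    assert (e0 : forall c : C, (c - 0)%C = c) by (intros; ring). rewrite e0. lra.
Qed.

Lemma root4_function :
  exists rt : C -> C, forall G, ~ (Im G = 0 /\ Re G <= 0) ->
    (rt G ^ 4)%C = G /\ 0 < Re (rt G) /\ 0 < Re (rt G ^ 2)%C.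
Proof.
  exists (fun G => epsilon (inhabits (RtoC 0))
                     (fun r => (r ^ 4)%C = G /\ 0 < Re r /\ 0 < Re (r ^ 2)%C)).
  intros G hG. apply (epsilon_spec _ (fun r => (r ^ 4)%C = G /\ 0 < Re r /\ 0 < Re (r ^ 2)%C)).
  now apply Croot4_exists.
Qed.

Lemma kn_model_open (Z W : C2 -> C) (x : C2) :
  ccont Z x -> ccont W x -> kn_model (Z x) (W x) ->
  locally x (fun y => kn_model (Z y) (W y)).
Proof.
  intros hZ hW hm.
  assert (e : forall y, Re (W y + kn_weight_C (Z y) - RtoC (/ 100) * (Z y * Cconj (Z y)) ^ 4)%C
              = Re (W y) + kn_weight (Z y) - Cmod (Z y) ^ 8 / 100).
  { intros y. rewrite <- Cmod2_conj, <- RtoC_pow, <- RtoC_mult, <- Re_kn_weight_C.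
    unfold Re; simpl. field. }
  assert (hc : ccont (fun y => W y + kn_weight_C (Z y)
                        - RtoC (/ 100) * (Z y * Cconj (Z y)) ^ 4)%C x)
    by (unfold kn_weight_C; ccont_tac).
  unfold kn_model in *. rewrite <- e in hm.
  generalize (ccont_Re_lt _ _ _ hc hm). apply filter_imp. intros y. now rewrite e.
Qed.

Lemma peak_off_axis (p : C2) : fst p <> RtoC 0 -> Re (kn_defining p) = 0 ->
  exists f : C2 -> C, peak_function Omega_KN p f.
Proof.
  intros hz hp.
  destruct root_function as [tau htau]. destruct root4_function as [rt hrt].
  set (z0 := fst p : C) in *. set (w0 := snd p : C). set (y0 := (z0 * w0)%C).
  (* The boundary equation already gives [W p] the real part [- kn_weight z0]; [nu] corrects the
     imaginary part. *)
  set (nu := Im w0 + Im (kn_coef z0)). set (W := shear y0 nu).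
  assert (hWp : W p = (- kn_coef z0)%C).
  { assert (h1 := Re_shear y0 nu p). rewrite Re_kn_defining in hp.
    fold z0 w0 in h1, hp. fold y0 in h1, hp.
    replace (y0 - y0)%C with (RtoC 0) in h1 by ring. rewrite Cmod_0 in h1. fold W in h1.
    assert (h2 : Im (W p) = - Im (kn_coef z0)).
    { unfold W, shear. fold z0 w0. fold y0.
      replace (2 * Cconj y0 * y0)%C with (RtoC (2 * Cmod y0 ^ 2))
        by (rewrite RtoC_mult, Cmod2_conj; ring).
      unfold nu, Im; simpl. ring. }
    destruct (W p) as [a b]. simpl in h1, h2. unfold kn_coef, Copp in *. simpl in *.
    f_equal; lra. }
  set (k := tau z0 (- kn_coef z0)%C).
  assert (hz8 : 0 < Cmod z0 ^ 8) by (apply pow_lt; now apply Cmod_gt_0).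
  assert (hmp : kn_model z0 (- kn_coef z0)).
  { unfold kn_model. change (Re (- kn_coef z0)%C) with (- kn_weight z0). lra. }
  assert (hk : is_root z0 (- kn_coef z0) k) by now apply htau.
  assert (hk0 : k <> 0) by (apply Cmod_gt_0, cone_neq0, hk).
  destruct (support_small z0 k hz hk) as [M [hM [hpos hsmall]]].
  set (T := fun x : C2 => tau (fst x) (W x)).
  set (s := fun x : C2 => (fst x / z0)%C).
  set (G := fun x : C2 => (T x - k * s x ^ 2)%C).
  assert (hzs : forall x : C2, (z0 * s x)%C = fst x) by (intros x; unfold s; field; assumption).
  assert (hroot : forall x, Omega_KN x -> is_root (z0 * s x) (W x) (T x)).
  { intros x hx. rewrite hzs. apply htau, model_of_lt. now apply Omega_KN_model. }
  assert (hmodel : forall x, Omega_KN x -> Re (W x) + kn_weight (z0 * s x) < 0).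
  { intros x hx. rewrite hzs. now apply Omega_KN_model. }
  assert (hb : forall x, Omega_KN x ->
    (rt (G x) ^ 4)%C = G x /\ 0 < Re (rt (G x)) /\ 0 < Re (rt (G x) ^ 2)%C).
  { intros x hx. apply hrt. exact (kn_slit z0 k _ _ _ hz hk (hroot x hx) (hmodel x hx)). }
  assert (hden : forall x, Omega_KN x -> 1 <= Cmod (1 + T x / k)).
  { intros x hx. apply one_le_Cmod_one_plus_div; [apply (hroot x hx)|apply hk]. }
  assert (hds : forall x, diff_at s x).
  { intros x. apply ex_filterdiff_Cmult; [apply diff_fst|apply ex_filterdiff_Cconst]. }
  assert (hcs : forall x, ccont s x) by (intros x; apply ccont_of_diff, hds).
  assert (hcW : forall x, ccont W x) by (intros x; apply ccont_of_diff, diff_shear).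
  apply (peak_of_real_part _ _
    (fun x => M * rt (G x) + (s x - 1) ^ 2 / (1 + T x / k))%C Omega_KN_open).
  - intros x hx. assert (hO := Omega_KN_open x hx).
    assert (hdT : diff_at T x).
    { apply (root_diff (fun x : C2 => fst x) W); [apply diff_fst|apply diff_shear|].
      generalize hO. apply filter_imp. intros y hy. rewrite <- hzs. now apply hroot. }
    assert (hs1 : diff_at (fun y => (s y - 1) ^ 2)%C x).
    { assert (h : diff_at (fun y => s y - 1)%C x)
        by (apply ex_filterdiff_Cplus; [apply hds|apply ex_filterdiff_Cconst]).
      apply ex_filterdiff_Cmult; [exact h|].
      apply ex_filterdiff_Cmult; [exact h|apply ex_filterdiff_Cconst]. }
    apply ex_filterdiff_Cplus.
    + apply ex_filterdiff_Cscal. apply (Croot4_diff G).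
      * apply ex_filterdiff_Cplus; [exact hdT|].
        assert (h : diff_at (fun y => (- k) * (s y * s y))%C x)
          by (apply ex_filterdiff_Cscal, ex_filterdiff_Cmult; apply hds).
        revert h. apply ex_filterdiff_ext. intros y. simpl. ring.
      * generalize hO. apply filter_imp. exact hb.
    + apply ex_filterdiff_Cmult; [exact hs1|]. apply ex_filterdiff_Cinv.
      * apply ex_filterdiff_Cplus; [apply ex_filterdiff_Cconst|].
        apply ex_filterdiff_Cmult; [exact hdT|apply ex_filterdiff_Cconst].
      * generalize hO. apply filter_imp. intros y hy. apply Cmod_gt_0.
        specialize (hden y hy). lra.
  - intros x hx. destruct (hb x hx) as [h1 [h2 h3]].
    exact (hpos _ _ _ _ (hroot x hx) (hmodel x hx) h1 h2 h3).
  - intros eps heps.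
    (* Here the slack puts [p] inside the open model, so the root exists and is continuous on a full
       neighborhood of [p], with value [k] at [p]. *)
    assert (hcT : ccont T p).
    { apply (root_ccont (fun x : C2 => fst x) W); [apply ccont_fst|apply hcW|].
      assert (h : locally p (fun y : C2 => kn_model (fst y) (W y))).
      { apply kn_model_open; [apply ccont_fst|apply hcW|]. fold z0. now rewrite hWp. }
      generalize h. apply filter_imp. intros y hy. now apply htau. }
    assert (hsp : s p = 1) by (unfold s; fold z0; field; assumption).
    assert (hGp : G p = 0).
    { unfold G. rewrite hsp. unfold T. fold z0. rewrite hWp. fold k. ring. }
    assert (hcG : ccont G p).
    { unfold G. apply ccont_minus; [assumption|].
      apply ccont_mult; [apply ccont_const|apply ccont_pow, hcs]. }
    set (e := eps / (2 * M)). assert (he : 0 < e) by (apply Rdiv_lt_0_compat; lra).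
    assert (he4 : 0 < e ^ 4) by (apply pow_lt; assumption).
    set (d := Rmin 1 (eps / 2)). assert (hd : 0 < d) by (apply Rmin_case; lra).
    assert (k1 := ccont_Cmod_lt _ _ _ hcG hGp he4).
    assert (k2 := hcs p d hd). rewrite hsp in k2.
    generalize (filter_and _ _ k1 k2). unfold within. apply filter_imp.
    intros x [h1 h2] hx. destruct (hb x hx) as [h3 _]. specialize (hden x hx).
    rewrite <- h3, Cmod_pow in h1.
    assert (hbe : Cmod (rt (G x)) < e).
    { apply Rnot_le_lt. intros h. assert (e ^ 4 <= Cmod (rt (G x)) ^ 4)
        by (apply pow_incr; lra). lra. }
    assert (h4 : Cmod (s x - 1) < 1) by (eapply Rlt_le_trans; [exact h2|apply Rmin_l]).
    assert (h5 : Cmod (s x - 1) < eps / 2) by (eapply Rlt_le_trans; [exact h2|apply Rmin_r]).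
    assert (h6 := Cmod_ge_0 (s x - 1)).
    assert (hne : (1 + T x / k)%C <> 0) by (apply Cmod_gt_0; lra).
    eapply Rle_lt_trans; [apply Cmod_triangle|].
    rewrite Cmod_mult, Cmod_R, Rabs_pos_eq, Cmod_div, Cmod_pow by (assumption || lra).
    assert (h7 : Cmod (s x - 1) ^ 2 / Cmod (1 + T x / k) <= Cmod (s x - 1)).
    { apply Rmult_le_reg_r with (Cmod (1 + T x / k)); [lra|].
      replace (Cmod (s x - 1) ^ 2 / Cmod (1 + T x / k) * Cmod (1 + T x / k))
        with (Cmod (s x - 1) * Cmod (s x - 1)) by (field; lra).
      apply Rmult_le_compat_l; lra. }
    assert (h8 : M * Cmod (rt (G x)) <= M * e) by (apply Rmult_le_compat_l; lra).
    replace (M * e) with (eps / 2) in h8 by (unfold e; field; lra). lra.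
  - intros r hr.
    assert (hy0 := Cmod_ge_0 y0).
    (* One [e] for [z], one for [W], [2 |y0| e] for undoing the shear, and one to spare. *)
    set (e := r / (3 + 2 * Cmod y0)). assert (he : 0 < e) by (apply Rdiv_lt_0_compat; lra).
    assert (her : e * (3 + 2 * Cmod y0) = r) by (unfold e; field; lra).
    assert (he2 : 0 < e ^ 2) by (apply pow_lt; assumption).
    (* On [Omega_KN] the point [x] is determined by [v = (s x, G x)] up to
       [|fst x * snd x - y0|], which the defining inequality controls. *)
    set (F1 := fun v : C2 => (- quartic ((z0 * fst v) ^ 6) 0 (k * fst v ^ 2 + snd v))%C).
    set (F2 := fun v : C2 => (F1 v + kn_weight_C (z0 * fst v))%C).
    set (v0 := (RtoC 1, RtoC 0) : C2).
    assert (hF1 : ccont F1 v0) by (unfold F1, quartic; ccont_tac).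
    assert (hF2 : ccont F2 v0) by (unfold F2, kn_weight_C; ccont_tac).
    assert (hF3 : ccont (fun v : C2 => z0 * fst v)%C v0) by ccont_tac.
    assert (hF1v : F1 v0 = (- kn_coef z0)%C).
    { unfold F1. simpl (fst v0). simpl (snd v0).
      transitivity (- quartic (z0 ^ 6) (- kn_coef z0) k - kn_coef z0)%C;
        [unfold quartic; ring|]. rewrite (proj2 hk). ring. }
    assert (hF2v : Re (F2 v0) = 0).
    { unfold F2. change (Re (F1 v0 + kn_weight_C (z0 * fst v0))%C)
        with (Re (F1 v0) + Re (kn_weight_C (z0 * fst v0)%C)).
      rewrite hF1v, Re_kn_weight_C. simpl (fst v0). rewrite Cmult_1_r.
      simpl. ring. }
    (* [Re F2] is [Re W + kn_weight z]; above [- e ^ 2], it leaves room only for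
       [|z w - y0| < e]. *)
    assert (hlt : - e ^ 2 < Re (F2 v0)) by lra.
    destruct (filter_and _ _ (hF1 e he)
      (filter_and _ _ (hF3 e he) (ccont_Re_gt _ _ _ hF2 hlt))) as [d hd].
    destruct (hsmall d (cond_pos d)) as [c [hc hcx]].
    exists c. split; [assumption|].
    intros x hx hball. apply Rnot_lt_le. intros hgc. apply hball.
    destruct (hb x hx) as [h1 [h2 h3]].
    destruct (hcx _ _ _ _ (hroot x hx) (hmodel x hx) h1 h2 h3 hgc) as [h4 h5].
    assert (hv : ball v0 d ((s x, G x) : C2)).
    { apply ball_C2; simpl; [assumption|].
      now replace (G x - 0)%C with (T x - k * s x ^ 2)%C by (unfold G; ring). }
    destruct (hd _ hv) as [h6 [h7 h8]].
    assert (hFW : F1 ((s x, G x) : C2) = W x).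
    { unfold F1. simpl (fst _). simpl (snd _).
      transitivity (W x - quartic ((z0 * s x) ^ 6) (W x) (T x))%C;
        [unfold quartic, G; ring|]. rewrite (proj2 (hroot x hx)). ring. }
    rewrite hFW, hF1v, <- hWp in h6.
    change (Cmod (z0 * s x - z0 * 1) < e) in h7. rewrite hzs, Cmult_1_r in h7.
    assert (hY : Cmod (fst x * snd x - y0) < e).
    { assert (h9 := Omega_KN_shear y0 nu x hx). fold W in h9.
      change (Re (F2 ((s x, G x) : C2)))
        with (Re (F1 ((s x, G x) : C2)) + Re (kn_weight_C (z0 * s x)%C)) in h8.
      rewrite hFW, Re_kn_weight_C, hzs in h8.
      apply Rnot_le_lt. intros h.
      assert (e ^ 2 <= Cmod (fst x * snd x - y0) ^ 2) by (apply pow_incr; lra). lra. }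
    assert (hw : Cmod (snd x - w0) <= e + 2 * Cmod y0 * e).
    { replace (snd x - w0)%C
        with ((W x - W p) + - (2 * Cconj y0 * (fst x * snd x - y0)))%C.
      - eapply Rle_trans; [apply Cmod_triangle|].
        rewrite Cmod_opp, !Cmod_mult, Cmod_conj, Cmod_R, Rabs_pos_eq by lra.
        apply Rplus_le_compat; [lra|]. apply Rmult_le_compat_l; lra.
      - unfold W, shear. fold z0 w0. unfold y0. ring. }
    unfold norm_ball. eapply Rle_lt_trans; [apply norm_C2_le|].
    fold z0 w0. lra.
Qed.

Theorem theorem4p6 (p : C2) (hp : boundary Omega_KN p) :
  exists f : C2 -> C, peak_function Omega_KN p f.
Proof.
  apply boundary_defining in hp.
  destruct (classic (fst p = RtoC 0)) as [h|h].
  - now apply peak_at_axis.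
  - now apply peak_off_axis.
Qed.
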